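(* Let $F$ be a field with $\operatorname{char} F \neq 2$, and let $L$ be a countable dimensional Lie algebra over $F$ that is locally of subexponential growth. Then $L$ is embeddable in a finitely generated Lie algebra of subexponential growth; that is, there exist a finitely generated Lie $F$-algebra $M$ of subexponential growth and an injective homomorphism of Lie $F$-algebras $L \to M$.
   Context: Let $A$ be a (not necessarily associative) algebra over a field $F$ generated by a finite dimensional subspace $V$. For $n \geq 1$, let $V^n$ be the subspace of $A$ spanned by all products $v_1 \cdots v_k$ with $k \leq n$, $v_i \in V$, with all possible arrangements of brackets (for a Lie algebra the product is the Lie bracket). The function $g(V,n) = \dim_F V^n$, $n\in N=\{1,2,\dots\}$, is called the growth function of $A$ with respect to the generating subspace $V$. A function $f: N \to [1,\infty)$ is subexponential if $\lim_{n\to\infty} f(n)/e^{\alpha n} = 0$ for every real $\alpha > 0$. A finitely generated algebra $A$ is of subexponential growth if $g(V,n)$ is a subexponential function for a finite dimensional generating subspace $V$ of $A$. This does not depend on the choice of $V$: for any two finite dimensional generating subspaces $V, W$ there is $C \in N$ with $g(V,n) \leq C\, g(W, Cn)$ and $g(W,n) \leq C\, g(V,Cn)$ for all $n \geq 1$. A not necessarily finitely generated algebra is locally of subexponential growth if every finitely generated subalgebra of it is of subexponential growth. *)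

(* Defs.v *)
From HB Require Import structures.
From mathcomp Require Import all_boot all_order all_algebra.
From mathcomp Require Import all_classical all_reals all_analysis.

Set Implicit Arguments.
Unset Strict Implicit.
Unset Printing Implicit Defensive.

Import Order.TTheory GRing.Theory Num.Theory.
Import numFieldNormedType.Exports.
Local Open Scope classical_set_scope.
Local Open Scope ring_scope.

Reserved Notation "x ** y" (at level 40, left associativity).

HB.mixin Record hasBilinearProduct (F : fieldType) A of GRing.Lmodule F A := {
  amul : A -> A -> A;
  amulDl : forall (a : F) (x y z : A),
    amul (a *: x + y) z = a *: amul x z + amul y z;
  amulDr : forall (a : F) (x y z : A),
    amul x (a *: y + z) = a *: amul x y + amul x z
}.

(* Neither associativity nor a unit is assumed. *)
#[short(type="nonassocAlgType")]
HB.structure Definition NonassocAlgebra (F : fieldType) :=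
  {A of GRing.Lmodule F A & hasBilinearProduct F A}.

Notation "x ** y" := (amul x y) : ring_scope.

HB.mixin Record isLie (F : fieldType) L of NonassocAlgebra F L := {
  lie_alternating : forall x : L, x ** x = 0;
  lie_jacobi : forall x y z : L,
    x ** (y ** z) + y ** (z ** x) + z ** (x ** y) = 0
}.

(* The product [x ** y] of a Lie algebra is its bracket. *)
#[short(type="lieAlgType")]
HB.structure Definition LieAlgebra (F : fieldType) :=
  {L of NonassocAlgebra F L & isLie F L}.

Section LinearAlgebra.
Variables (F : fieldType) (E : lmodType F).
Implicit Types (S U B : set E).

Definition subspace U : Prop :=
  U 0 /\ forall (a : F) x y, U x -> U y -> U (a *: x + y).

Definition lspan S : set E := smallest subspace S.

Definition lin_indep B : Prop :=
  forall (s : seq E) (c : E -> F), uniq s -> [set` s] `<=` B ->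
    \sum_(x <- s) c x *: x = 0 -> forall x, x \in s -> c x = 0.

Definition is_basis U B : Prop := lin_indep B /\ lspan B = U.

Definition has_dim U (d : nat) : Prop :=
  exists2 B, is_basis U B & (B #= `I_d)%card.

Definition fin_dim U : Prop := exists d, has_dim U d.

(* The junk value 0 is taken when [U] is not a finite dimensional subspace. *)
Definition dimension U : nat := xget 0%N [set d | has_dim U d].

(* [countable] includes the finite case. *)
Definition countable_dim : Prop :=
  exists2 B, is_basis [set: E] B & countable B.

End LinearAlgebra.

Section Growth.
Variables (R : realType) (F : fieldType) (A : nonassocAlgType F).
Implicit Types (S V B : set A).

Definition subalgebra B : Prop :=
  subspace B /\ forall x y, B x -> B y -> B (x ** y).

Definition generated_subalgebra S : set A := smallest subalgebra S.

(* [bracketed V k x]: x is a product of k elements of V, with some arrangement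
   of brackets. *)
Inductive bracketed V : nat -> A -> Prop :=
| Bracketed1 v of V v : bracketed V 1 v
| BracketedM k l x y of bracketed V k x & bracketed V l y :
    bracketed V (k + l) (x ** y).

Definition power V (n : nat) : set A :=
  lspan [set x | exists2 k, (k <= n)%N & bracketed V k x].

Definition growth V (n : nat) : nat := dimension (power V n).

(* Growth functions are indexed by n >= 1; the value at 0 has no effect on the
   limit.  No lower bound 1 <= f n is imposed, so that the zero algebra, whose
   growth function is 0, has subexponential growth. *)
Definition subexponential (f : nat -> R) : Prop :=
  forall alpha : R, 0 < alpha ->
    (fun n => f n / expR (alpha * n%:R)) @ \oo --> (0 : R).

(* A subalgebra is a subset of the ambient algebra [A]; as it is closed under
   products, the growth function of a generating subspace is the same whether
   computed in [A] or in the subalgebra. *)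
Definition finitely_generated B : Prop :=
  exists2 S, finite_set S & generated_subalgebra S = B.

Definition subexponential_growth B : Prop :=
  exists V, [/\ fin_dim V, generated_subalgebra V = B
    & subexponential (fun n => (growth V n)%:R)].

Definition locally_subexponential_growth : Prop :=
  forall B, finitely_generated B -> subexponential_growth B.

End Growth.

Definition lie_hom (F : fieldType) (L M : lieAlgType F) (f : {linear L -> M}) :
  Prop := forall x y : L, f (x ** y) = f x ** f y.

Arguments countable_dim {F} E.
Arguments subexponential_growth R {F A} B.
Arguments locally_subexponential_growth R {F} A.

(* Main.v *)
(* The universal enveloping algebra of L acts on the symmetric algebra of L
   (Poincare-Birkhoff-Witt), so L has a faithful module V.  Spread a basis
   [a_n] of L along a sparse sequence of positions [k_n]: [b_r = a_n] if
   [r = k_n], and [b_r = 0] otherwise.  If the [k_n] grow fast enough, the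
   filtration of L in which [b_r] has weight [r] has subexponential growth, and
   so has the induced filtration of the enveloping algebra: its growth is at
   most that of the ordered monomials, which is controlled by
   [\prod_w (1 - z ^ w)^-d(w)].

   M is generated by five infinite matrices over End(W), W = V^nat, with rows
   and columns indexed by nat: [c = \sum_r b_r e_(r,0)],
   [t = \sum_(r > 0) e_(r,r+1)], [e_(1,1)], [p e_(0,1)] and [q e_(1,1)], where
   [p] and [q] commute with L and [pq - qp = 1].  Commutators with [t] turn
   [e_(1,1)] into [e_(1,r)], then [[e_(1,r), c] = b_r e_(1,0)], and bracketing
   with [p e_(0,1)] and with [q e_(1,1)] yields [b_r e_(1,1)].  Hence M contains
   the copy [L e_(1,1)] of L, and the associative algebra generated by the five
   matrices has subexponential growth because every product collapses to
   [t^s], [w e_(i,j)] with [i <= 1], or [t^s c (w e_(0,j))]. *)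
From HB Require Import structures.
Require Import Defs.
From mathcomp Require Import all_boot all_order all_algebra.
From mathcomp Require Import all_classical all_reals all_analysis.
From mathcomp Require Import ring lra zify.

(* [all_analysis] shadows [subspace]. *)
Import Defs.

Set Implicit Arguments.
Unset Strict Implicit.
Unset Printing Implicit Defensive.

Import Order.TTheory GRing.Theory Num.Theory.
Import numFieldNormedType.Exports.
Local Open Scope classical_set_scope.
Local Open Scope ring_scope.

(** * Spanning sets and dimension *)

Section Span.
Variables (F : fieldType) (E : lmodType F).
Implicit Types (S U B : set E) (s t : seq E).

Lemma lspan_subspace S : subspace (lspan S).
Proof.
split=> [U /= [[U0 _] _] //|a x y Sx Sy U /= [Us SU]].
by apply: Us.2; [apply: Sx|apply: Sy].
Qed.

Lemma sub_lspan S : S `<=` lspan S.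
Proof. exact: sub_gen_smallest. Qed.

Lemma lspan_min S U : subspace U -> S `<=` U -> lspan S `<=` U.
Proof. by move=> Us SU; apply: smallest_sub. Qed.

Lemma lspanS S B : S `<=` B -> lspan S `<=` lspan B.
Proof.
by move=> SB; apply: lspan_min (lspan_subspace B) (subset_trans SB (@sub_lspan B)).
Qed.

Section Closure.
Variables (U : set E) (Us : subspace U).

Lemma subspace0 : U 0. Proof. exact: Us.1. Qed.

Lemma subspaceZ a x : U x -> U (a *: x).
Proof. by move=> Ux; have := Us.2 a _ _ Ux Us.1; rewrite addr0. Qed.

Lemma subspaceD x y : U x -> U y -> U (x + y).
Proof. by move=> Ux Uy; have := Us.2 1 _ _ Ux Uy; rewrite scale1r. Qed.

Lemma subspaceN x : U x -> U (- x).
Proof. by move=> Ux; rewrite -scaleN1r; apply: subspaceZ. Qed.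

Lemma subspaceB x y : U x -> U y -> U (x - y).
Proof. by move=> Ux Uy; apply: subspaceD => //; apply: subspaceN. Qed.

Lemma subspace_sum I (r : seq I) (P : pred I) (G : I -> E) :
  (forall i, P i -> U (G i)) -> U (\sum_(i <- r | P i) G i).
Proof.
by move=> UG; apply: (big_ind U subspace0 subspaceD).
Qed.

End Closure.

Lemma lspan_seqP s x : lspan [set` s] x ->
  exists c : nat -> F, x = \sum_(i < size s) c i *: s`_i.
Proof.
apply: (lspan_min (U := [set x | exists c : nat -> F,
  x = \sum_(i < size s) c i *: s`_i])) => [|y /= ys].
  split=> /= [|a y z [c ->] [d ->]].
    by exists (fun=> 0); rewrite big1 // => i _; rewrite scale0r.
  exists (fun i => a * c i + d i); rewrite scaler_sumr -big_split /=.
  by apply: eq_bigr => i _; rewrite scalerDl scalerA.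
exists (fun i => (i == index y s)%:R).
have ys' : (index y s < size s)%N by rewrite index_mem.
rewrite (bigD1 (Ordinal ys')) //= eqxx scale1r nth_index // big1 ?addr0 // => i.
by rewrite -val_eqE /= => /negbTE ->; rewrite scale0r.
Qed.

(** A dimension bound for arbitrary sets: it passes to subsets and linear images before any subspace
    structure or basis is available. *)
Definition spanned U n := exists2 s, (size s <= n)%N & U `<=` lspan [set` s].

Lemma spannedS U B n : U `<=` B -> spanned B n -> spanned U n.
Proof. by move=> UB [s sn Us]; exists s => //; apply: subset_trans UB Us. Qed.

(** If [t] were longer than [s], the matrix of coefficients of [t] over [s] would have more rows
    than columns; a nonzero vector in its left kernel is a linear relation on [t]. *)
Lemma lin_indep_size s t : uniq t -> lin_indep [set` t] ->
  [set` t] `<=` lspan [set` s] -> (size t <= size s)%N.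
Proof.
move=> ut it ts; rewrite leqNgt; apply/negP => lt_st.
have /choice [c cP] : forall i : 'I_(size t), exists c : nat -> F,
    t`_i = \sum_(j < size s) c j *: s`_j.
  by move=> i; apply: lspan_seqP; apply: ts; apply: mem_nth; apply: ltn_ord.
pose A := \matrix_(i < size t, j < size s) c i j.
have /rowV0Pn[u /sub_kermxP uA u0] : kermx A != 0.
  rewrite -mxrank_eq0 mxrank_ker subn_eq0 -ltnNge.
  exact: leq_ltn_trans (rank_leq_col A) lt_st.
case/eqP: u0; apply/rowP => i; rewrite mxE.
pose d x := if insub (index x t) is Some j then u 0 j else 0.
have dE (j : 'I_(size t)) : d t`_j = u 0 j.
  by rewrite /d index_uniq // valK.
rewrite -dE; apply: (it t d) => //; last exact: mem_nth.
rewrite (big_nth 0) big_mkord.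
under eq_bigr => j _ do rewrite dE cP scaler_sumr.
rewrite exchange_big big1 //= => k _.
under eq_bigr => j _ do rewrite scalerA.
rewrite -scaler_suml.
have /matrixP/(_ 0 k) := uA; rewrite !mxE.
by under eq_bigr => j _ do rewrite mxE; move=> ->; rewrite scale0r.
Qed.

Lemma card_seqE s : uniq s -> ([set` s] #= `I_(size s))%card.
Proof.
elim: s => [|x s IHs] /=; first by rewrite set_nil II0; move=> _; exact: card_eq00.
case/andP=> xs us; apply/eq_cardSP; exists x; first by rewrite /= mem_head.
suff -> : [set` x :: s] `\ x = [set` s] by exact: IHs.
apply/seteqP; split=> [y /= [] |y /= ys].
  by rewrite inE => /predU1P[->|].
by split; [rewrite inE ys orbT|move=> yx; rewrite -yx ys in xs].
Qed.

Lemma has_dim_seq U d : has_dim U d ->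
  exists s, [/\ uniq s, size s = d, lin_indep [set` s] & lspan [set` s] = U].
Proof.
case=> B [iB sB] cB; have /finite_seqP[s Bs] : finite_set B.
  by apply/finite_setP; exists d.
have {}Bs : B = [set` undup s].
  by rewrite Bs; apply/seteqP; split=> x /=; rewrite mem_undup.
exists (undup s); split; rewrite -?Bs ?undup_uniq //.
by apply/card_eq_II; rewrite -(card_eql (card_seqE (undup_uniq s))) -Bs.
Qed.

Lemma has_dim_uniq U d d' : has_dim U d -> has_dim U d' -> d = d'.
Proof.
move=> /has_dim_seq[s [us <- iS sU]] /has_dim_seq[t [ut <- it tU]].
by apply/eqP; rewrite eqn_leq !lin_indep_size ?sU -?tU //; last rewrite tU -sU;
  apply: sub_lspan.
Qed.

(** Independent lists in [U] have at most [n] elements, so a longest one exists, and maximality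
    forces it to span [U]. *)
Lemma spanned_has_dim U n : subspace U -> spanned U n ->
  exists2 d, (d <= n)%N & has_dim U d.
Proof.
move=> Us [s sn sU].
pose P d := `[< exists t, [/\ uniq t, size t = d, lin_indep [set` t]
  & [set` t] `<=` U] >].
have P0 : exists d, P d.
  by exists 0%N; apply/asboolP; exists [::]; split=> // t c _ /(_ _ _)t0 _ x /t0.
have Pn d : P d -> (d <= n)%N.
  move=> /asboolP[t [ut <- it tU]]; apply: leq_trans sn.
  by apply: lin_indep_size ut it _; apply: subset_trans tU sU.
case: (ex_maxnP P0 Pn) => d Pd dmax; exists d; first exact: Pn.
move: Pd => /asboolP[t [ut td it tU]]; exists [set` t]; last first.
  by rewrite -td; apply: card_seqE.
split=> //; apply/seteqP; split; first exact: lspan_min.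
move=> x Ux; apply: contrapT => tx.
have xt : x \notin t by apply/negP => xt; apply: tx; apply: sub_lspan.
suff : P d.+1 by move=> /dmax; rewrite ltnn.
apply/asboolP; exists (x :: t); split=> /=; rewrite ?xt ?td //; last first.
  by move=> y /=; rewrite inE => /predU1P[->|/tU].
(* A nonzero coefficient at [x] would put [x] in the span of [t]. *)
move=> r c ur rxt rc; have xr0 : x \in r -> c x = 0.
  move=> xr; apply: contrapT => /eqP cx0; apply: tx.
  move: rc; rewrite (bigD1_seq x) //= => /eqP; rewrite addr_eq0 => /eqP rc.
  rewrite -[x]scale1r -(mulVf cx0) -scalerA rc.
  apply: subspaceZ (lspan_subspace _) _ _ _.
  apply: subspaceN (lspan_subspace _) _ _.
  rewrite big_seq_cond; apply: subspace_sum (lspan_subspace _) _ _ _ _ _.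
  move=> y /andP[yr yx]; apply: subspaceZ (lspan_subspace _) _ _ _.
  apply: sub_lspan => /=; have /= := rxt y yr.
  by rewrite inE (negbTE yx).
move=> y yr; have [yx|yx] := eqVneq y x; first by rewrite yx xr0 -?yx.
apply: (it [seq z <- r | z != x] c); rewrite ?filter_uniq //.
- move=> z /=; rewrite mem_filter => /andP[zx /rxt /=].
  by rewrite inE (negbTE zx).
- rewrite big_filter; move: rc; rewrite (bigID (fun z => z != x)) /=.
  rewrite [X in _ + X]big_seq_cond [X in _ + X]big1 ?addr0 // => z.
  by rewrite negbK => /andP[zr /eqP zx]; rewrite zx xr0 ?scale0r -?zx.
- by rewrite mem_filter yx.
Qed.

Lemma dimensionE U d : has_dim U d -> dimension U = d.
Proof.
move=> Ud; rewrite /dimension; case: xgetP => [_ -> /= Ud'|/(_ d)//].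
exact: has_dim_uniq Ud' Ud.
Qed.

Lemma dimension_le U n : subspace U -> spanned U n -> (dimension U <= n)%N.
Proof.
by move=> Us /(spanned_has_dim Us)[d dn /dimensionE ->].
Qed.

Lemma spanned_dimension U n :
  subspace U -> spanned U n -> spanned U (dimension U).
Proof.
move=> Us /(spanned_has_dim Us)[d _ Ud]; rewrite (dimensionE Ud).
by case/has_dim_seq: Ud => s [_ <- _ sU]; exists s; rewrite ?sU.
Qed.

Lemma spannedU_lspan S n T m : spanned S n -> spanned T m ->
  spanned (lspan (S `|` T)) (n + m).
Proof.
move=> [s sn Ss] [t tm Tt]; exists (s ++ t); first by rewrite size_cat leq_add.
apply: lspan_min (lspan_subspace _) _ => x [/Ss|/Tt];
  apply: lspanS => y /=; rewrite mem_cat => ->; rewrite ?orbT //.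
Qed.

Lemma spanned_lspan S n : spanned S n -> spanned (lspan S) n.
Proof.
by move=> [s sn Ss]; exists s => //; apply: lspan_min (lspan_subspace _) Ss.
Qed.

End Span.

Lemma spanned_bigcup (F : fieldType) (E : lmodType F) (T : eqType) (r : seq T)
    (G : T -> set E) (n : T -> nat) :
  (forall i, i \in r -> spanned (G i) (n i)) ->
  spanned [set x | exists2 i, i \in r & G i x] (\sum_(i <- r) n i).
Proof.
elim: r => [_|i r IHr Gr]; first by exists [::] => // x [].
rewrite big_cons; have Gi := Gr i (mem_head i r).
have {}IHr := IHr (fun j jr => Gr j (mem_behead (s := i :: r) jr)).
apply: spannedS (spannedU_lspan Gi IHr) => x [j].
by rewrite inE => /predU1P[->|jr] Gx; apply: sub_lspan; [left|right; exists j].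
Qed.

Lemma spanned_image (F : fieldType) (E E' : lmodType F) (U : set E) n
    (f : {linear E -> E'}) : spanned U n -> spanned (f @` U) n.
Proof.
move=> [s sn sU]; exists (map f s); first by rewrite size_map.
move=> _ [x /sU xs <-].
have : subspace (f @^-1` (lspan [set` map f s])).
  split=> [|a u v] /=; first by rewrite linear0; apply: (lspan_subspace _).1.
  by rewrite linearP; apply: (lspan_subspace _).2.
move=> Us; apply: (lspan_min Us _ xs) => y /= ys.
by apply: sub_lspan; apply: map_f.
Qed.

(** A list spanning [U] may leave the range of [f]; it is replaced by a basis of the intersection of
    [U] with the range, which can be lifted along [f]. *)
Lemma spanned_preimage (F : fieldType) (E E' : lmodType F) (U : set E') n
    (f : {linear E -> E'}) : injective f -> subspace U ->
  spanned U n -> spanned (f @^-1` U) n.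
Proof.
move=> fI Us Un.
have fU : subspace (U `&` range f).
  split; first by split; [apply: subspace0|exists 0; rewrite ?linear0].
  move=> a u v [Uu [x _ xu]] [Uv [y _ yv]]; split; first exact: Us.2.
  by exists (a *: x + y); rewrite ?linearP ?xu ?yv.
have [|d dn /has_dim_seq[s [_ sd _ sU]]] := spanned_has_dim fU (n := n).
  by apply: spannedS Un => x [].
have /choice[g gP] : forall y, exists x, y \in s -> f x = y.
  move=> y; case ys : (y \in s); last by exists 0.
  have [_ [x _ fx]] : (U `&` range f) y by rewrite -sU; apply: sub_lspan.
  by exists x.
exists (map g s); first by rewrite size_map sd.
move=> x /= Ux; have : lspan [set` s] (f x) by rewrite sU; split=> //; exists x.
move=> /lspan_seqP[c fx].
suff -> : x = \sum_(i < size s) c i *: g s`_i.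
  apply: subspace_sum (lspan_subspace _) _ _ _ _ _ => i _.
  apply: subspaceZ (lspan_subspace _) _ _ _.
  by apply: sub_lspan => /=; rewrite map_f ?mem_nth.
apply: fI; rewrite fx linear_sum; apply: eq_bigr => i _.
by rewrite linearZ /= gP ?mem_nth.
Qed.

(** * Linear endomorphisms and generated Lie algebras *)

Record endo (F : fieldType) (E : lmodType F) :=
  Endo { endo_fun :> E -> E; endo_linear : linear endo_fun }.

Section EndoTheory.
Variables (F : fieldType) (E : lmodType F).
Implicit Types f g h : endo E.

HB.instance Definition _ f :=
  GRing.isLinear.Build F E E *:%R (endo_fun f) (endo_linear f).

HB.instance Definition _ := gen_eqMixin (endo E).
HB.instance Definition _ := gen_choiceMixin (endo E).

Lemma endoP f g : (forall x, f x = g x) -> f = g.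
Proof.
case: f g => [f fL] [g gL] /= fg; have {}fg : f = g by apply/funext.
by rewrite fg in fL *; congr Endo; apply: Prop_irrelevance.
Qed.

Fact endo0_linear : linear (fun _ : E => 0 : E).
Proof. by move=> a x y; rewrite scaler0 addr0. Qed.

Fact endo_opp_linear f : linear (fun x => - f x).
Proof. by move=> a x y; rewrite linearP opprD scalerN. Qed.

Fact endo_add_linear f g : linear (fun x => f x + g x).
Proof. by move=> a x y; rewrite !linearP scalerDr addrACA. Qed.

Fact endo_scale_linear a f : linear (fun x => a *: f x).
Proof. by move=> b x y; rewrite linearP scalerDr !scalerA mulrC. Qed.

Fact endo1_linear : linear (fun x : E => x).
Proof. by []. Qed.

Fact endo_mul_linear f g : linear (fun x => f (g x)).
Proof. by move=> a x y; rewrite !linearP. Qed.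

Let add f g := Endo (endo_add_linear f g).
Let opp f := Endo (endo_opp_linear f).
Let zero := Endo endo0_linear.

Fact endo_addA : associative add.
Proof. by move=> f g h; apply: endoP => x; apply: addrA. Qed.

Fact endo_addC : commutative add.
Proof. by move=> f g; apply: endoP => x; apply: addrC. Qed.

Fact endo_add0 : left_id zero add.
Proof. by move=> f; apply: endoP => x; apply: add0r. Qed.

Fact endo_addN : left_inverse zero opp add.
Proof. by move=> f; apply: endoP => x; apply: addNr. Qed.

HB.instance Definition _ :=
  GRing.isZmodule.Build (endo E) endo_addA endo_addC endo_add0 endo_addN.

Lemma endoDE f g x : (f + g) x = f x + g x. Proof. by []. Qed.
Lemma endoBE f g x : (f - g) x = f x - g x. Proof. by []. Qed.

Let one := Endo endo1_linear.
Let mul f g := Endo (endo_mul_linear f g).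

Fact endo_mulA : associative mul.
Proof. by move=> f g h; apply: endoP. Qed.

Fact endo_mul1 : left_id one mul.
Proof. by move=> f; apply: endoP. Qed.

Fact endo_mulr1 : right_id one mul.
Proof. by move=> f; apply: endoP. Qed.

Fact endo_mulDl : left_distributive mul +%R.
Proof. by move=> f g h; apply: endoP. Qed.

Fact endo_mulDr : right_distributive mul +%R.
Proof. by move=> f g h; apply: endoP => x; apply: linearD. Qed.

HB.instance Definition _ := GRing.Zmodule_isPzRing.Build (endo E)
  endo_mulA endo_mul1 endo_mulr1 endo_mulDl endo_mulDr.

Lemma endoME f g x : (f * g) x = f (g x). Proof. by []. Qed.

Let scale a f := Endo (endo_scale_linear a f).

Fact endo_scaleA a b f : scale a (scale b f) = scale (a * b) f.
Proof. by apply: endoP => x; apply: scalerA. Qed.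

Fact endo_scale1 : left_id 1 scale.
Proof. by move=> f; apply: endoP => x; apply: scale1r. Qed.

Fact endo_scaleDr : right_distributive scale +%R.
Proof. by move=> a f g; apply: endoP => x; apply: scalerDr. Qed.

Fact endo_scaleDl f : {morph scale^~ f : a b / a + b}.
Proof. by move=> a b; apply: endoP => x; apply: scalerDl. Qed.

HB.instance Definition _ := GRing.Zmodule_isLmodule.Build F (endo E)
  endo_scaleA endo_scale1 endo_scaleDr endo_scaleDl.

Lemma endoZE a f x : (a *: f) x = a *: f x. Proof. by []. Qed.

Lemma endo_scaleAl a f g : a *: (f * g) = (a *: f) * g.
Proof. by apply: endoP. Qed.

Lemma endo_scaleAr a f g : a *: (f * g) = f * (a *: g).
Proof. by apply: endoP => x; rewrite endoME !endoZE linearZ. Qed.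

Let bracket f g := f * g - g * f.

Fact endo_bracketDl a f g h :
  bracket (a *: f + g) h = a *: bracket f h + bracket g h.
Proof.
rewrite /bracket mulrDl mulrDr -endo_scaleAl -endo_scaleAr scalerBr opprD.
by rewrite addrACA.
Qed.

Fact endo_bracketDr a f g h :
  bracket f (a *: g + h) = a *: bracket f g + bracket f h.
Proof.
rewrite /bracket mulrDl mulrDr -endo_scaleAl -endo_scaleAr scalerBr opprD.
by rewrite addrACA.
Qed.

HB.instance Definition _ :=
  hasBilinearProduct.Build F (endo E) endo_bracketDl endo_bracketDr.

Lemma endo_bracketE f g : f ** g = f * g - g * f.
Proof. by []. Qed.

Fact endo_alternating f : f ** f = 0.
Proof. exact: subrr. Qed.

Fact endo_jacobi f g h :
  f ** (g ** h) + g ** (h ** f) + h ** (f ** g) = 0.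
Proof.
rewrite !endo_bracketE !mulrBr !mulrBl !mulrA.
have subACA (a b c d : endo E) : a - b - (c - d) = a - c + (d - b).
  by rewrite opprB [d - c]addrC addrACA [- b + d]addrC.
by rewrite !subACA [X in X + _]addrACA !subrKA addrACA !subrKA !subrr addr0.
Qed.

HB.instance Definition _ := isLie.Build F (endo E) endo_alternating endo_jacobi.

End EndoTheory.

Section GeneratedLie.
Variables (F : fieldType) (L : lieAlgType F) (S : set L).

Lemma generated_subalgebraP : subalgebra (generated_subalgebra S).
Proof.
split; first split=> [U [[[]]] //|a x y Sx Sy U US].
  by apply: US.1.1.2; [apply: Sx|apply: Sy].
by move=> x y Sx Sy U US; apply: US.1.2; [apply: Sx|apply: Sy].
Qed.

(** Makes a type of the generated subalgebra, since the target of the embedding must itself be a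
    [lieAlgType] and not a subset of one. *)
Record gen_lie := GenLie { gen_val : L; gen_valP : generated_subalgebra S gen_val }.
Implicit Types x y z : gen_lie.

HB.instance Definition _ := gen_eqMixin gen_lie.
HB.instance Definition _ := gen_choiceMixin gen_lie.

Lemma gen_val_inj : injective gen_val.
Proof.
move=> [x xS] [y yS] /= xy; rewrite xy in xS *; congr GenLie.
exact: Prop_irrelevance.
Qed.

Let gsub := generated_subalgebraP.1.
Let zero := GenLie (subspace0 gsub).
Let add x y := GenLie (subspaceD gsub (gen_valP x) (gen_valP y)).
Let opp x := GenLie (subspaceN gsub (gen_valP x)).
Let scale a x := GenLie (subspaceZ gsub a (gen_valP x)).
Let bracket x y := GenLie (generated_subalgebraP.2 _ _ (gen_valP x) (gen_valP y)).

Fact gen_addA : associative add.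
Proof. by move=> x y z; apply: gen_val_inj; apply: addrA. Qed.

Fact gen_addC : commutative add.
Proof. by move=> x y; apply: gen_val_inj; apply: addrC. Qed.

Fact gen_add0 : left_id zero add.
Proof. by move=> x; apply: gen_val_inj; apply: add0r. Qed.

Fact gen_addN : left_inverse zero opp add.
Proof. by move=> x; apply: gen_val_inj; apply: addNr. Qed.

HB.instance Definition _ :=
  GRing.isZmodule.Build gen_lie gen_addA gen_addC gen_add0 gen_addN.

Fact gen_scaleA a b x : scale a (scale b x) = scale (a * b) x.
Proof. by apply: gen_val_inj; apply: scalerA. Qed.

Fact gen_scale1 : left_id 1 scale.
Proof. by move=> x; apply: gen_val_inj; apply: scale1r. Qed.

Fact gen_scaleDr : right_distributive scale +%R.
Proof. by move=> a x y; apply: gen_val_inj; apply: scalerDr. Qed.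

Fact gen_scaleDl x : {morph scale^~ x : a b / a + b}.
Proof. by move=> a b; apply: gen_val_inj; apply: scalerDl. Qed.

HB.instance Definition _ := GRing.Zmodule_isLmodule.Build F gen_lie
  gen_scaleA gen_scale1 gen_scaleDr gen_scaleDl.

Fact gen_bracketDl a x y z :
  bracket (a *: x + y) z = a *: bracket x z + bracket y z.
Proof. by apply: gen_val_inj; apply: amulDl. Qed.

Fact gen_bracketDr a x y z :
  bracket x (a *: y + z) = a *: bracket x y + bracket x z.
Proof. by apply: gen_val_inj; apply: amulDr. Qed.

HB.instance Definition _ :=
  hasBilinearProduct.Build F gen_lie gen_bracketDl gen_bracketDr.

Fact gen_alternating x : x ** x = 0.
Proof. by apply: gen_val_inj; apply: lie_alternating. Qed.

Fact gen_jacobi x y z : x ** (y ** z) + y ** (z ** x) + z ** (x ** y) = 0.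
Proof. by apply: gen_val_inj; apply: lie_jacobi. Qed.

HB.instance Definition _ := isLie.Build F gen_lie gen_alternating gen_jacobi.

Fact gen_val_linear : linear gen_val.
Proof. by []. Qed.

HB.instance Definition _ :=
  GRing.isLinear.Build F gen_lie L *:%R gen_val gen_val_linear.

Lemma gen_valM x y : gen_val (x ** y) = gen_val x ** gen_val y.
Proof. by []. Qed.

End GeneratedLie.

(** * The Poincare-Birkhoff-Witt module *)

Section LinearExtension.
Variables (F : fieldType) (V : lmodType F).
Implicit Types (phi : nat -> V) (p q : {poly F}).

Definition lext phi p := \sum_(i < size p) p`_i *: phi i.

Lemma lext_widen phi p n : (size p <= n)%N ->
  lext phi p = \sum_(i < n) p`_i *: phi i.
Proof.
move=> pn; rewrite /lext (big_ord_widen n (fun i => p`_i *: phi i) pn).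
rewrite [RHS](bigID (fun i : 'I_n => (i < size p)%N)) /=.
rewrite [X in _ + X]big1 ?addr0 // => i.
by rewrite -leqNgt => /(nth_default 0) ->; rewrite scale0r.
Qed.

Lemma lext_linear phi : linear (lext phi).
Proof.
move=> a p q; pose n := maxn (size (a *: p + q)) (maxn (size p) (size q)).
rewrite !(@lext_widen _ _ n) ?leq_max ?leqnn ?orbT //.
rewrite scaler_sumr -big_split; apply: eq_bigr => i _ /=.
by rewrite coefD coefZ scalerDl scalerA.
Qed.

HB.instance Definition _ phi :=
  GRing.isLinear.Build F {poly F} V *:%R (lext phi) (lext_linear phi).

Lemma lextX phi i : lext phi 'X^i = phi i.
Proof.
rewrite /lext size_polyXn (bigD1 ord_max) //= coefXn eqxx scale1r.
rewrite big1 ?addr0 // => j; rewrite -val_eqE /= coefXn => /negbTE ->.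
by rewrite scale0r.
Qed.

End LinearExtension.

Lemma lext_in (F : fieldType) (V : lmodType F) (U : set V) (phi : nat -> V) p :
  subspace U -> (forall i, U (phi i)) -> U (lext phi p).
Proof.
by move=> Us Uphi; apply: subspace_sum => // i _; apply: subspaceZ.
Qed.

Lemma poly_in (F : fieldType) (U : set {poly F}) :
  subspace U -> (forall i, U 'X^i) -> forall p, U p.
Proof.
move=> Us UX p; rewrite -[p]coefK poly_def; apply: subspace_sum => // i _.
exact: subspaceZ.
Qed.

Section PBW.
Variables (F : fieldType) (br : {poly F} -> {poly F} -> {poly F}).
Hypotheses (br_linearl : forall z, linear (br ^~ z))
  (br_linearr : forall x, linear (br x)) (br_alt : forall x, br x x = 0)
  (br_jacobi : forall x y z, br x (br y z) + br y (br z x) + br z (br x y) = 0).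
Implicit Types (s t : seq nat) (u v w : {poly F}).

(* The polynomial ring plays two roles: the Lie algebra, with basis ['X^i], and
   its symmetric algebra, where the monomial with index multiset [s] is ['X^k]
   for the code [k] of the sorted list [s]; the other ['X^k] are junk, on which
   the Lie algebra acts by zero. *)
Definition mon s : {poly F} := 'X^(CodeSeq.code (sort leq s)).

Lemma mon_perm s t : perm_eq s t -> mon s = mon t.
Proof.
move=> st; congr ('X^(CodeSeq.code _)).
exact/(perm_sortP leq_total leq_trans anti_leq).
Qed.

Definition on_sorted (phi : seq nat -> {poly F}) (k : nat) :=
  let s := CodeSeq.decode k in if sorted leq s then phi s else 0.

Lemma lext_mon phi s : lext (on_sorted phi) (mon s) = phi (sort leq s).
Proof.
rewrite lextX /on_sorted CodeSeq.codeK sort_sorted //; exact: leq_total.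
Qed.

(* The action is forced by [X_i X_j = X_j X_i + [X_i, X_j]] for [j < i], where
   [X_i m_t] agrees with the monomial [mon (i :: t)] up to lower degree terms, on
   which [X_j] is already known; [n] is fuel. *)
Fixpoint act n i s : {poly F} :=
  match s, n with
  | [::], _ => mon [:: i]
  | _ :: _, 0%N => 0
  | j :: t, n'.+1 =>
      mon (i :: s) + (if (i <= j)%N then 0 else
        lext (on_sorted (act n' j)) (act n' i t - mon (i :: t)) +
        lext (fun k => act n' k t) (br 'X^i 'X^j))
  end.

Lemma actS n i j t : act n.+1 i (j :: t) =
  mon (i :: j :: t) + (if (i <= j)%N then 0 else
    lext (on_sorted (act n j)) (act n i t - mon (i :: t)) +
    lext (fun k => act n k t) (br 'X^i 'X^j)).
Proof. by []. Qed.

(** The degree filtration of the symmetric algebra; the junk powers of ['X] belong to none of its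
    terms. *)
Definition deg_le n : set {poly F} :=
  lspan [set mon s | s in [set s | size s <= n]%N].

Lemma deg_le_sub n : subspace (deg_le n). Proof. exact: lspan_subspace. Qed.

Lemma deg_le_mon s n : (size s <= n)%N -> deg_le n (mon s).
Proof. by move=> sn; apply: sub_lspan; exists s. Qed.

Lemma deg_leS m n : (m <= n)%N -> deg_le m `<=` deg_le n.
Proof.
move=> mn; apply: lspanS => _ [s sm <-]; exists s => //=.
exact: leq_trans mn.
Qed.

Lemma deg_le_lext n m phi w : (forall s, sorted leq s -> (size s <= n)%N ->
    deg_le m (phi s)) -> deg_le n w -> deg_le m (lext (on_sorted phi) w).
Proof.
move=> Hphi; suff : deg_le n `<=` lext (on_sorted phi) @^-1` deg_le m by apply.
apply: lspan_min.
  split=> [|a x y] /=; first by rewrite linear0; apply: subspace0 (deg_le_sub _).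
  by rewrite linearP; apply: (deg_le_sub _).2.
move=> _ [s sn <-] /=; rewrite lext_mon; apply: Hphi; last by rewrite size_sort.
by apply: sort_sorted; apply: leq_total.
Qed.

Lemma eq_lext_deg_le n phi psi w : (forall s, sorted leq s -> (size s <= n)%N ->
    phi s = psi s) -> deg_le n w ->
  lext (on_sorted phi) w = lext (on_sorted psi) w.
Proof.
move=> Hphi; apply: (lspan_min (U := [set w | lext (on_sorted phi) w =
  lext (on_sorted psi) w])).
  split=> [|a x y] /=; first by rewrite !linear0.
  by move=> Ex Ey; rewrite linearP /= Ex Ey -linearP.
move=> _ [s sn <-] /=; rewrite !lext_mon; apply: Hphi; last by rewrite size_sort.
by apply: sort_sorted; apply: leq_total.
Qed.

(** The correction in [act] applies [X_j] to an element of degree at most [size t], and the various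
    [X_k] to [t] itself; by induction each of them raises the degree by at most one. *)
Lemma act_deg_le n s i : (size s <= n)%N -> sorted leq s ->
  deg_le (size s) (act n i s - mon (i :: s)).
Proof.
elim: n s i => [|n IHn] [|j t] i //= tn st.
- by rewrite subrr; apply: subspace0 (deg_le_sub _).
- by rewrite subrr; apply: subspace0 (deg_le_sub _).
have st' := path_sorted st.
have act_deg_leS k s : (size s <= size t)%N -> sorted leq s ->
    deg_le (size t).+1 (act n k s).
  move=> zs ss; rewrite -[act n k s](subrK (mon (k :: s))).
  apply: (subspaceD (deg_le_sub _)); last exact: deg_le_mon.
  by apply: deg_leS (IHn _ _ (leq_trans zs tn) ss); apply: leqW.
rewrite addrAC subrr add0r; case: ifP => _; first exact: (subspace0 (deg_le_sub _)).
apply: (subspaceD (deg_le_sub _)).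
  by apply: deg_le_lext (IHn _ i tn st') => s ss zs; apply: act_deg_leS.
by apply: lext_in (deg_le_sub _) _ => k; apply: act_deg_leS.
Qed.

(** By [act_deg_le], recursive calls only concern monomials of degree at most [size t], so fuel
    equal to the length of the list suffices. *)
Lemma act_fuel n s i : (size s <= n)%N -> sorted leq s ->
  act n i s = act (size s) i s.
Proof.
move=> + ss; move: n.
have step m t k : (size t <= m)%N -> sorted leq t -> act m.+1 k t = act m k t.
  elim: m t k => [|m IHm] [|j t] k // tm st; have st' := path_sorted st.
  rewrite actS [RHS]actS; congr (_ + _); case: ifP => // _; congr (_ + _).
    rewrite (IHm _ _ tm st').
    apply: (eq_lext_deg_le _ (act_deg_le k (tm : size t <= m)%N st')).
    by move=> s0 ss0 zs; apply: IHm ss0; apply: leq_trans zs tm.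
  by apply: eq_bigr => r _; rewrite (IHm _ _ tm st').
move=> n /subnKC <-; elim: (n - size s)%N => [|m IHm]; first by rewrite addn0.
by rewrite addnS step ?leq_addr.
Qed.

Definition opX i w : {poly F} := lext (on_sorted (fun s => act (size s) i s)) w.

Definition op u w : {poly F} := lext (fun i => opX i w) u.

Lemma op_linearr u : linear (op u).
Proof.
move=> a w w'; rewrite /op /lext scaler_sumr -big_split /=.
apply: eq_bigr => i _; rewrite /opX linearP scalerDr !scalerA.
by rewrite [u`_i * a]mulrC.
Qed.

HB.instance Definition _ u :=
  GRing.isLinear.Build F {poly F} {poly F} *:%R (op u) (op_linearr u).

Lemma opXE i w : op 'X^i w = opX i w.
Proof. exact: lextX. Qed.

Lemma opX_deg_le i s : deg_le (size s) (op 'X^i (mon s) - mon (i :: s)).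
Proof.
have ss : sorted leq (sort leq s) by apply: sort_sorted; apply: leq_total.
rewrite opXE /opX lext_mon -(size_sort leq s).
have -> : mon (i :: s) = mon (i :: sort leq s).
  by apply: mon_perm; rewrite perm_cons perm_sym perm_sort.
exact: act_deg_le.
Qed.

Lemma op_le i s : all (leq i) s -> op 'X^i (mon s) = mon (i :: s).
Proof.
rewrite opXE /opX lext_mon => lis.
have -> : mon (i :: s) = mon (i :: sort leq s).
  by apply: mon_perm; rewrite perm_cons perm_sym perm_sort.
have : all (leq i) (sort leq s) by rewrite all_sort.
by case: (sort leq s) => //= j t /andP[-> _]; rewrite addr0.
Qed.

(** The recursion of [act] restated for operators, with the fuel gone. Sorting [t] first is harmless
    because [mon] depends only on the multiset. *)
Lemma op_gt i j t : (j < i)%N -> all (leq j) t ->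
  op 'X^i (mon (j :: t)) = mon (i :: j :: t) +
    op 'X^j (op 'X^i (mon t) - mon (i :: t)) + op (br 'X^i 'X^j) (mon t).
Proof.
wlog st : t / sorted leq t => [hw|] ji ljt.
  have ss : sorted leq (sort leq t) by apply: sort_sorted; apply: leq_total.
  have pt : perm_eq t (sort leq t) by rewrite perm_sym perm_sort.
  have mc x : mon (x :: t) = mon (x :: sort leq t).
    by apply: mon_perm; rewrite perm_cons.
  have mcc : mon [:: i, j & t] = mon [:: i, j & sort leq t].
    by apply: mon_perm; rewrite !perm_cons.
  by rewrite !mc mcc (mon_perm pt); apply: hw; rewrite ?all_sort.
have sjt : sorted leq (j :: t) by rewrite /= path_min_sorted.
rewrite opXE {1}/opX lext_mon (sorted_sort leq_trans sjt) /= leqNgt ji /= -addrA.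
congr (_ + (_ + _)).
  rewrite !opXE /opX [lext _ (mon t)]lext_mon (sorted_sort leq_trans st).
  apply: (eq_lext_deg_le _ (act_deg_le i (leqnn _) st)) => s ss zs.
  by rewrite act_fuel.
apply: eq_bigr => k _; rewrite /opX lext_mon.
by rewrite (sorted_sort leq_trans st).
Qed.

Let opB u v w : op (u - v) w = op u w - op v w.
Proof. exact: linearB. Qed.

Let op0 w : op 0 w = 0.
Proof. exact: linear0. Qed.

Let opP a u v w : op (a *: u + v) w = a *: op u w + op v w.
Proof. exact: linearP. Qed.

Let opBr u v w : op u (v - w) = op u v - op u w.
Proof. exact: linearB. Qed.

Let opr0 u : op u 0 = 0.
Proof. exact: linear0. Qed.

Let opPr a u v w : op u (a *: v + w) = a *: op u v + op u w.
Proof. exact: op_linearr. Qed.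

Let opN u w : op (- u) w = - op u w.
Proof. exact: linearN. Qed.

Let brP a x y z : br (a *: x + y) z = a *: br x z + br y z.
Proof. exact: br_linearl. Qed.

Let brPr a x y z : br x (a *: y + z) = a *: br x y + br x z.
Proof. exact: br_linearr. Qed.

Let br_anti x y : br x y = - br y x.
Proof.
apply/eqP; rewrite -addr_eq0; apply/eqP.
have := br_alt (x + y).
have brD (z t r : {poly F}) : br (z + t) r = br z r + br t r.
  by rewrite -[z]scale1r brP !scale1r.
have brDr (z t r : {poly F}) : br z (t + r) = br z t + br z r.
  by rewrite -[t]scale1r brPr !scale1r.
by rewrite brD !brDr !br_alt add0r addr0.
Qed.

Let br0 z : br 0 z = 0.
Proof. by have := brP (-1) z z z; rewrite !scaleN1r !addNr. Qed.

Let br0r z : br z 0 = 0.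
Proof. by rewrite br_anti br0 oppr0. Qed.

Let brNr x y : br x (- y) = - br x y.
Proof. by rewrite -[- y]addr0 -scaleN1r brPr br0r addr0 scaleN1r. Qed.

Definition commutator_law w u v :=
  op u (op v w) - op v (op u w) = op (br u v) w.

Definition commutes w := forall u v, commutator_law w u v.

Lemma commutator_law_subspace u v : subspace [set w | commutator_law w u v].
Proof.
split=> [|a x y]; rewrite /= /commutator_law; first by rewrite !opr0 subrr.
by move=> xP yP; rewrite !opPr -xP -yP scalerBr opprD addrACA.
Qed.

Lemma commutes_subspace : subspace commutes.
Proof.
split=> [u v|a x y xP yP u v]; first exact: (subspace0 (commutator_law_subspace u v)).
exact: ((commutator_law_subspace u v).2 a x y (xP u v) (yP u v)).
Qed.

Lemma commutator_law_sym w u v : commutator_law w u v -> commutator_law w v u.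
Proof.
by rewrite /commutator_law => uv; rewrite br_anti opN -uv opprB.
Qed.

Lemma commutes_basis w :
  (forall i j, (j < i)%N -> commutator_law w 'X^i 'X^j) -> commutes w.
Proof.
move=> wP; have {}wP i j : commutator_law w 'X^i 'X^j.
  case: (ltngtP i j) => [ij|ji|->]; first exact/commutator_law_sym/wP.
    exact: wP.
  by rewrite /commutator_law br_alt subrr op0.
move=> u v; move: u; apply: poly_in => [|i].
  split=> [|a x y xP yP]; rewrite /commutator_law.
    by rewrite br0 !op0 opr0 subrr.
  by rewrite brP !opP opPr -xP -yP scalerBr opprD addrACA.
move: v; apply: poly_in => [|j]; last exact: wP.
split=> [|a x y xP yP]; rewrite /commutator_law.
  by rewrite br0r !op0 opr0 subrr.
by rewrite brPr !opP opPr -xP -yP scalerBr opprD addrACA.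
Qed.

(** Here [X_j] acts on [mon t] by plain multiplication, so the commutator relation is exactly the
    recursion that defines [X_i] on [j :: t]. *)
Lemma op_commutes_min i j t : (j < i)%N -> all (leq j) t ->
  commutator_law (mon t) 'X^i 'X^j.
Proof.
move=> ji ljt; rewrite /commutator_law (op_le ljt) op_gt // linearB /=.
have -> : op 'X^j (mon (i :: t)) = mon [:: i, j & t].
  rewrite op_le /= ?(ltnW ji) //; apply: mon_perm.
  by rewrite -![[:: _, _ & t]]/([:: _; _] ++ t) perm_cat2r (perm_catC [:: j] [:: i]).
by rewrite addrCA subrr addr0 addrAC subrr add0r.
Qed.

(** Induction on the degree. Let [k] be the least index of [s]. If [j <= k], the relation holds by
    definition of the action; otherwise [mon (k :: t)] is [X_k] applied to [mon t], and moving [X_k]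
    to the front uses only known relations. What remains is the Jacobi identity. *)
Lemma mon_commutes s : commutes (mon s).
Proof.
have [n sn] := ubnP (size s); elim: n s sn => // n IHn s sn.
have deg_le_commutes m : (m < n)%N -> deg_le m `<=` commutes.
  move=> mn; apply: lspan_min commutes_subspace _ => _ [t tm <-].
  by apply: IHn; apply: leq_ltn_trans tm mn.
apply: commutes_basis => i j ji.
have sS : sorted leq (sort leq s) by apply: sort_sorted; apply: leq_total.
rewrite (mon_perm (s := s) (t := sort leq s)); last by rewrite perm_sym perm_sort.
move: sn sS; rewrite -(size_sort leq); case: (sort leq s) => [|k t] tn st.
  exact: op_commutes_min.
have kt : all (leq k) t by apply: order_path_min st; apply: leq_trans.
have [jk|kj] := leqP j k.
  apply: op_commutes_min => //=; rewrite jk.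
  by apply: sub_all kt => x; apply: leq_trans.
have tC : commutes (mon t) by apply: IHn.
(* [X_m] sends [mon t] to [mon (m :: t)] plus terms of degree at most [size t]: the latter are
   covered by induction, and [k] is minimal in [m :: t]. *)
have key l m : (k < l)%N -> (k < m)%N ->
    op 'X^l (op 'X^k (op 'X^m (mon t))) =
    op 'X^k (op 'X^l (op 'X^m (mon t))) + op (br 'X^l 'X^k) (op 'X^m (mon t)).
  move=> kl km; suff : commutator_law (op 'X^m (mon t)) 'X^l 'X^k.
    by rewrite /commutator_law => <-; rewrite addrC subrK.
  rewrite -[op 'X^m (mon t)](subrK (mon (m :: t))).
  apply: (subspaceD (commutator_law_subspace _ _)) => /=.
    by apply: (deg_le_commutes (size t)); [|exact: opX_deg_le].
  by apply: op_commutes_min => //=; rewrite (ltnW km).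
(* The two middle terms are exchanged when [l] and [m] are, so they cancel in the commutator. *)
have expand l m : (k < l)%N -> (k < m)%N -> op 'X^l (op 'X^m (mon (k :: t))) =
    op 'X^k (op 'X^l (op 'X^m (mon t))) + op (br 'X^l 'X^k) (op 'X^m (mon t)) +
    op (br 'X^m 'X^k) (op 'X^l (mon t)) + op (br 'X^l (br 'X^m 'X^k)) (mon t).
  move=> kl km; rewrite -(op_le kt).
  have -> : op 'X^m (op 'X^k (mon t)) =
      op 'X^k (op 'X^m (mon t)) + op (br 'X^m 'X^k) (mon t).
    by rewrite -tC addrC subrK.
  rewrite linearD /= key // -!addrA; congr (_ + (_ + _)).
  by rewrite -[op (br 'X^l _) _]tC addrC subrK.
rewrite /commutator_law !expand //; do ?exact: ltn_trans ji.
rewrite -(op_le kt) -[RHS](subrK (op 'X^k (op (br 'X^i 'X^j) (mon t)))).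
rewrite [X in _ = X + _]tC -[op (br 'X^i 'X^j) (mon t)]tC opBr.
rewrite [br (br _ _) _]br_anti.
have -> : - br 'X^k (br 'X^i 'X^j) =
    br 'X^i (br 'X^j 'X^k) - br 'X^j (br 'X^i 'X^k).
  apply/eqP; rewrite eq_sym -subr_eq0 opprK; apply/eqP.
  rewrite -[RHS](br_jacobi 'X^i 'X^j 'X^k); congr (_ + _ + _).
  rewrite [br 'X^k 'X^i]br_anti.
  by rewrite brNr.
rewrite opB; ring.
Qed.

(** Powers of ['X] that encode no sorted list are annihilated by all operators, so only the
    monomials matter. *)
Lemma op_commutes w : commutes w.
Proof.
move: w; apply: poly_in commutes_subspace _ => k.
have op_on u : op u 'X^k = if sorted leq (CodeSeq.decode k)
    then op u (mon (CodeSeq.decode k)) else 0.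
  case: ifP => [ss|ns].
    by rewrite /mon (sorted_sort leq_trans ss) CodeSeq.decodeK.
  rewrite /op /lext big1 // => i _.
  by rewrite /opX lextX /on_sorted ns scaler0.
case: (boolP (sorted leq (CodeSeq.decode k))) op_on => [ss|_] op_on u v.
  have -> : 'X^k = mon (CodeSeq.decode k) :> {poly F}.
    by rewrite /mon (sorted_sort leq_trans ss) CodeSeq.decodeK.
  exact: mon_commutes.
by rewrite /commutator_law !op_on !opr0 subrr.
Qed.

(** Faithfulness is visible on the empty monomial: [X_i] sends it to [mon [:: i]], from which [psi]
    recovers ['X^i]. *)
Lemma op_inj u : op u (mon [::]) = 0 -> u = 0.
Proof.
pose psi k : {poly F} := if CodeSeq.decode k is [:: i] then 'X^i else 0.
move=> u0; have <- : lext psi (op u (mon [::])) = u.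
  rewrite /op {2}/lext linear_sum -[RHS]coefK poly_def; apply: eq_bigr => i _.
  by rewrite linearZ /= /opX lext_mon /= lextX /psi CodeSeq.codeK.
by rewrite u0 linear0.
Qed.

Lemma pbw : exists rho : {linear {poly F} -> endo {poly F}},
  (forall u v, rho (br u v) = rho u ** rho v) /\ injective rho.
Proof.
pose rho u := Endo (op_linearr u).
have rho_linear : linear rho by move=> a u v; apply: endoP => w; apply: opP.
pose rhoL := GRing.isLinear.Build F {poly F} (endo {poly F}) *:%R rho rho_linear.
pose rho' : {linear {poly F} -> endo {poly F}} := HB.pack rho rhoL.
exists rho'; split=> [u v|u v uv].
  by apply: endoP => w; symmetry; apply: op_commutes.
apply: subr0_eq; apply: op_inj; rewrite opB; apply/eqP; rewrite subr_eq0; apply/eqP.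
exact: (congr1 (fun f : endo {poly F} => endo_fun f (mon [::])) uv).
Qed.

End PBW.

(** * Coordinates on a Lie algebra of countable dimension *)

Section CountableBasis.
Variables (F : fieldType) (L : lieAlgType F) (B : set L) (g : L -> nat).
Hypotheses (B_free : lin_indep B) (B_span : lspan B = [set: L])
  (gI : {in B &, injective g}).

(** The graph of the coordinate map of the basis [B]: freeness makes it single-valued and the
    spanning property makes it total. *)
Let H : set (L * {poly F}) := lspan [set (x, 'X^(g x)) | x in B].

Let sum_extend (V : lmodType F) (f : L -> V) (c : L -> F) (s r : seq L) :
  uniq s -> uniq r -> {subset s <= r} ->
  \sum_(x <- s) c x *: f x = \sum_(x <- r) (if x \in s then c x else 0) *: f x.
Proof.
move=> us ur sr; rewrite [RHS](bigID (mem s)) /= [X in _ + X]big1 ?addr0.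
  under [RHS]eq_bigr => i -> do [].
  rewrite -[RHS]big_filter.
  apply: perm_big; apply: uniq_perm; rewrite ?filter_uniq // => x.
  by rewrite mem_filter; case xs : (x \in s); rewrite //= sr.
by move=> x /negbTE ->; rewrite scale0r.
Qed.

Let HE l p : H (l, p) -> exists s c, [/\ uniq s, [set` s] `<=` B,
  l = \sum_(x <- s) c x *: x & p = \sum_(x <- s) c x *: 'X^(g x)].
Proof.
move=> lp; suff : [set z : L * {poly F} | exists s c, [/\ uniq s, [set` s] `<=` B,
  z.1 = \sum_(x <- s) c x *: x & z.2 = \sum_(x <- s) c x *: 'X^(g x)]] (l, p) by [].
apply: lspan_min lp => [|_ [x Bx <-]]; last first.
  exists [:: x], (fun=> 1); split=> //=; rewrite ?big_seq1 ?scale1r //.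
  by move=> y /=; rewrite inE => /eqP ->.
split=> [|a [x x'] [y y'] /= [s [c [us sB -> ->]]] [t [d [ut tB -> ->]]]].
  by exists [::], (fun=> 0); rewrite !big_nil; split.
pose r := undup (s ++ t); have ur : uniq r by apply: undup_uniq.
have sr : {subset s <= r} by move=> z zs; rewrite mem_undup mem_cat zs.
have tr : {subset t <= r} by move=> z zt; rewrite mem_undup mem_cat zt orbT.
exists r, (fun z => a * (if z \in s then c z else 0) +
                    (if z \in t then d z else 0)).
split=> //; first by move=> z /=; rewrite mem_undup mem_cat => /orP[/sB|/tB].
- rewrite (sum_extend id c us ur sr) (sum_extend id d ut ur tr) scaler_sumr.
  by rewrite -big_split; apply: eq_bigr => z _; rewrite scalerDl scalerA.
- rewrite (sum_extend _ c us ur sr) (sum_extend _ d ut ur tr) scaler_sumr.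
  by rewrite -big_split; apply: eq_bigr => z _; rewrite scalerDl scalerA.
Qed.

Let H_fun l p q : H (l, p) -> H (l, q) -> p = q.
Proof.
move=> lp lq; apply: subr0_eq.
have : H (l - l, p - q) by exact: (subspaceB (lspan_subspace _) lp lq).
rewrite subrr => /HE[s [c [us sB /esym s0 ->]]].
rewrite big_seq big1 // => x xs; rewrite (B_free us sB s0 xs).
exact: scale0r.
Qed.

Let H_total l : exists p, H (l, p).
Proof.
have : lspan B l by rewrite B_span.
apply: (lspan_min (U := [set l | exists p, H (l, p)])) => [|x Bx]; last first.
  by exists 'X^(g x); apply: sub_lspan; exists x.
split=> [|a x y [p xp] [q yq]]; first by exists 0; apply: (lspan_subspace _).1.
by exists (a *: p + q); apply: (lspan_subspace _).2 a (x, p) (y, q) xp yq.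
Qed.

Lemma countable_dim_embedding : exists rho : {linear L -> endo {poly F}},
  lie_hom rho /\ injective rho.
Proof.
have /choice[kappa kP] := H_total.
have k_linear : linear kappa.
  move=> a x y; apply: H_fun (kP _) _.
  exact: (lspan_subspace _).2 a (x, kappa x) (y, kappa y) (kP x) (kP y).
pose kL := GRing.isLinear.Build F L {poly F} *:%R kappa k_linear.
pose k : {linear L -> {poly F}} := HB.pack kappa kL.
(* [pi] is a left inverse of [k] that kills ['X^i] when [i] is not the [g]-value of a basis element
   (the default of [xget]). Through it the bracket of L extends to the whole polynomial space. *)
pose pi := lext (fun i => xget 0 [set x | B x /\ g x = i]).
have kK : cancel k pi.
  move=> l; suff : [set z | pi z.2 = z.1] (l, k l) by [].
  apply: lspan_min (kP l) => [|_ [x Bx <-]] /=.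
    split=> [|a x y /= xP yP]; first exact: linear0.
    by rewrite -xP -yP; apply: linearP.
  rewrite /pi lextX; case: xgetP => [y -> [By gxy]|/(_ x)[]//].
  by apply: gI; rewrite ?inE.
have piP a u v : pi (a *: u + v) = a *: pi u + pi v by exact: linearP.
pose br u v := k (pi u ** pi v).
have [||||rho [rhoM rhoI]] := pbw (br := br).
- by move=> z a x y; rewrite /br piP amulDl linearP.
- by move=> z a x y; rewrite /br piP amulDr linearP.
- by move=> x; rewrite /br lie_alternating linear0.
- by move=> x y z; rewrite /br !kK -!linearD lie_jacobi linear0.
exists (rho \o k); split=> [x y|] /=; last exact: inj_comp rhoI (can_inj kK).
by rewrite -rhoM /br !kK.
Qed.

End CountableBasis.

(** * Growth of enveloping algebras *)

Section Products.
Variables (F : fieldType) (E : lmodType F).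
Local Notation A := (endo E).
Implicit Types (G : nat -> A -> Prop) (x y p : A).

(** [G k x] makes [x] a generator of weight [k]; the first index counts the factors, the second adds
    up their weights. *)
Inductive wprod G : nat -> nat -> A -> Prop :=
| Wprod1 : wprod G 0 0 1
| WprodM r n k x p of G k x & wprod G r n p : wprod G r.+1 (k + n) (x * p).

Lemma wprod_sub G G' r n p : (forall k x, G k x -> G' k x) ->
  wprod G r n p -> wprod G' r n p.
Proof. by move=> GG'; elim=> [|r' n' k x p' /GG' Gx _]; constructor. Qed.

Lemma wprod_mul G r n p r' n' p' : wprod G r n p -> wprod G r' n' p' ->
  wprod G (r + r') (n + n') (p * p').
Proof.
move=> Gp Gp'; elim: Gp => [|s m k x q Gx _ IH]; first by rewrite mul1r.
by rewrite addSn -addnA -mulrA; apply: WprodM.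
Qed.

Lemma wprod_exp G k x e : G k x -> wprod G e (e * k) (x ^+ e).
Proof.
move=> Gx; elim: e => [|e IH]; first by rewrite mul0n expr0; constructor.
by rewrite mulSn exprS; constructor.
Qed.

Lemma lspan_mul (S T V : set A) x y :
  (forall s t, S s -> T t -> V (s * t)) ->
  lspan S x -> lspan T y -> lspan V (x * y).
Proof.
move=> STV Sx Ty.
have Vs := lspan_subspace V.
suff : S `<=` [set x | lspan V (x * y)].
  move/lspan_min; apply=> //; split=> [|a u v] /=.
    by rewrite mul0r; apply: subspace0.
  by rewrite mulrDl -endo_scaleAl; apply: Vs.2.
move=> s Ss /=; suff : T `<=` [set y | lspan V (s * y)].
  move/lspan_min; apply=> //; split=> [|a u v] /=.
    by rewrite mulr0; apply: subspace0.
  by rewrite mulrDr -endo_scaleAr; apply: Vs.2.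
by move=> t Tt; apply: sub_lspan; apply: STV.
Qed.

Variable Lam : nat -> set A.
Hypothesis (Lam_comm : forall k l x y, Lam k x -> Lam l y -> Lam (k + l) (x * y - y * x)).

(** Positive weights leave finitely many exponents available in each total weight. *)
Definition pos_gen k x := (0 < k)%N /\ Lam k x.

(** The error terms of reordering: strictly fewer factors, no more weight. *)
Definition shorter r n : set A := lspan [set p | exists r' n',
  [/\ (r' < r)%N, (n' <= n)%N & wprod pos_gen r' n' p]].

Lemma shorter_sub r n : subspace (shorter r n).
Proof. exact: lspan_subspace. Qed.

Lemma shorterS r n r' n' : (r <= r')%N -> (n <= n')%N ->
  shorter r n `<=` shorter r' n'.
Proof.
move=> rr nn; apply: lspanS => p [s [m [sr mn Gp]]]; exists s, m; split=> //.
  exact: leq_trans sr rr.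
exact: leq_trans mn nn.
Qed.

Lemma shorter_mul s m x r n p : wprod pos_gen s m x -> shorter r n p ->
  shorter (s + r) (m + n) (x * p).
Proof.
move=> Gx; apply: (lspan_mul _ (sub_lspan (S := [set x]) erefl)).
move=> _ q -> [r' [n' [rr nn Gq]]]; exists (s + r')%N, (m + n')%N.
by rewrite ltn_add2l leq_add2l; split=> //; apply: wprod_mul.
Qed.

(* Moving a generator past another one costs their bracket, that is, a product
   with one factor less and the same total weight. *)
Lemma push_left k x w y e r n p : pos_gen k x -> pos_gen w y ->
  wprod pos_gen r n p ->
  shorter (e + r).+1 (k + (e * w + n)) (x * (y ^+ e * p) - y ^+ e * (x * p)).
Proof.
move=> Gx Gy Gp; elim: e => [|e IHe].
  by rewrite expr0 !mul1r subrr; apply: subspace0 (shorter_sub _ _).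
have -> : x * (y ^+ e.+1 * p) - y ^+ e.+1 * (x * p) =
    (x * y - y * x) * (y ^+ e * p) +
    y * (x * (y ^+ e * p) - y ^+ e * (x * p)).
  by rewrite exprS mulrBl mulrBr !mulrA addrA subrK.
apply: (subspaceD (shorter_sub _ _)).
  apply: sub_lspan; exists (1 + (e + r))%N, (k + w + (e * w + n))%N; split=> //.
    by rewrite mulSn !addnA.
  rewrite add1n; constructor; last by apply: wprod_mul Gp; apply: wprod_exp.
  split; first by rewrite addn_gt0 Gx.1.
  by apply: Lam_comm; [case: Gx|case: Gy].
have Gy1 : wprod pos_gen 1 w y.
  by rewrite -[y]mulr1 -[w]addn0; constructor => //; constructor.
have := shorter_mul Gy1 IHe; rewrite add1n !addSn; apply: shorterS => //.
by rewrite mulSn addnCA leq_add2l !addnA leqnn.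
Qed.

Definition list_gen (ys : seq (nat * A)) k x := (k, x) \in ys.

(** Each occurrence of [y] is pushed to the front by [push_left]; the remaining factor [q] involves
    only the other generators. *)
Lemma collect_left w y ys r n p : pos_gen w y ->
  (forall k x, list_gen ys k x -> pos_gen k x) ->
  wprod (list_gen ((w, y) :: ys)) r n p ->
  exists e s m q, [/\ wprod (list_gen ys) s m q, (e + s = r)%N,
    (e * w + m = n)%N & shorter r n (p - y ^+ e * q)].
Proof.
move=> Gy Gys; elim=> [|r' n' k x p' xys _ [e [s [m [q [Gq es em IH]]]]]].
  exists 0%N, 0%N, 0%N, 1; split=> //; first by constructor.
  by rewrite expr0 mulr1 subrr; apply: subspace0 (shorter_sub _ _).
have Gx : pos_gen k x.
  by move: xys; rewrite /list_gen inE => /predU1P[[-> ->]|/Gys].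
have Gx1 : wprod pos_gen 1 k x.
  by rewrite -[x]mulr1 -[k]addn0; constructor => //; constructor.
have IHx := shorter_mul Gx1 IH; rewrite add1n mulrBr in IHx.
move: xys; rewrite /list_gen inE => /predU1P[[kw xy]|xys].
  exists e.+1, s, m, q; split=> //; rewrite ?addSn ?es //.
    by rewrite mulSn -addnA em kw.
  by rewrite exprS -mulrA -{1}xy.
exists e, s.+1, (k + m)%N, (x * q); split.
- by constructor.
- by rewrite addnS es.
- by rewrite addnCA em.
rewrite -[_ - _](subrKA (x * (y ^+ e * q))); apply: (subspaceD (shorter_sub _ _)) => //.
have := push_left (e := e) Gx Gy (wprod_sub Gys Gq).
by rewrite es em.
Qed.

(** Ordered monomials of weight at most [N], with factors in the order of [ys]. For positive weights
    the cutoff [e <= N] loses nothing. *)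
Fixpoint mons (ys : seq (nat * A)) (N : nat) : seq A :=
  if ys is (w, y) :: ys' then
    flatten [seq [seq y ^+ e * m | m <- mons ys' (N - e * w)%N]
      | e <- iota 0 N.+1 & (e * w <= N)%N]
  else [:: 1].

Lemma monsE w y ys N : mons ((w, y) :: ys) N =
  flatten [seq [seq y ^+ e * m | m <- mons ys (N - e * w)%N]
    | e <- iota 0 N.+1 & (e * w <= N)%N].
Proof. by []. Qed.

Lemma mons_cons w y ys e q n N : (0 < w)%N -> (e * w + n <= N)%N ->
  q \in mons ys n ->
  (forall m, (n <= m)%N -> {subset mons ys n <= mons ys m}) ->
  y ^+ e * q \in mons ((w, y) :: ys) N.
Proof.
move=> w0 eN qn nm; apply/flatten_mapP; exists e.
  rewrite mem_filter mem_iota add0n ltnS (leq_trans _ eN) ?leq_addr //=.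
  by apply: leq_trans eN; apply: leq_trans (leq_addr _ _); apply: leq_pmulr.
apply: map_f; apply: nm qn.
by rewrite leq_subRL ?(leq_trans _ eN) ?leq_addr.
Qed.

Lemma mons_le ys n m : all (fun z => 0 < z.1)%N ys -> (n <= m)%N ->
  {subset mons ys n <= mons ys m}.
Proof.
elim: ys n m => [|[w y] ys IH] n m; first by move=> _ _ x.
move=> /andP[w0 ys0] nm x; rewrite monsE => /flatten_mapP[e].
rewrite mem_filter => /andP[en _] /mapP[q qm ->].
apply: (@mons_cons w y ys e q (n - e * w)%N m w0 _ qm) => [|l]; last exact: IH.
by rewrite subnKC // (leq_trans en nm).
Qed.

Lemma wprod_mons ys r n p : (forall k x, list_gen ys k x -> pos_gen k x) ->
  wprod (list_gen ys) r n p ->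
  exists2 q, q \in mons ys n & shorter r n (p - q).
Proof.
elim: ys r n p => [|[w y] ys IH] r n p Gys Gp.
  case: Gp => [|s m k x q //]; exists 1; rewrite ?inE //.
  by rewrite subrr; apply: subspace0 (shorter_sub _ _).
have Gy : pos_gen w y by apply: Gys; rewrite /list_gen inE eqxx.
have {}Gys k x : list_gen ys k x -> pos_gen k x.
  by move=> kx; apply: Gys; rewrite /list_gen inE [_ \in _]kx orbT.
have [e [s [m [q [Gq es em pq]]]]] := collect_left Gy Gys Gp.
have [q' q'm qq'] := IH _ _ _ Gys Gq.
exists (y ^+ e * q').
  apply: (@mons_cons w y ys e q' m n _ _ q'm) => [||l]; [by case: Gy|by rewrite em|].
  by apply: mons_le; apply/allP => -[k x] kx /=; case: (Gys k x kx).
rewrite -[_ - _](subrKA (y ^+ e * q)); apply: (subspaceD (shorter_sub _ _)) => //.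
rewrite -mulrBr -es -em; apply: shorter_mul qq'.
exact: wprod_exp.
Qed.

Lemma wprod_expand G G' r n p : (forall k x, G k x -> (k <= n)%N ->
    lspan [set y | G' k y] x) -> wprod G r n p ->
  lspan [set q | wprod G' r n q] p.
Proof.
move=> GG' Gp; elim: Gp GG' => [_|s m k x q Gx _ IH GG'].
  by apply: sub_lspan; constructor.
apply: lspan_mul (GG' k x Gx (leq_addr _ _)) (IH _) => [y z|l y Gy lm].
  exact: WprodM.
by apply: GG' Gy _; apply: leq_trans lm (leq_addl _ _).
Qed.

(** The spanning half of Poincare-Birkhoff-Witt, with weights: sorting a product leaves an ordered
    monomial and shorter products that are not heavier, so induction on the number of factors
    applies. *)
Lemma shorter_mons ys N : (forall k x, list_gen ys k x -> pos_gen k x) ->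
  (forall k x, pos_gen k x -> (k <= N)%N -> lspan [set y | list_gen ys k y] x) ->
  forall r, shorter r N `<=` lspan [set` mons ys N].
Proof.
move=> Gys span_ys; elim=> [|r IHr]; apply: lspan_min (lspan_subspace _) _.
  by move=> p [s [m []]].
move=> p [s [n [sr nN Gp]]].
have : lspan [set q | wprod (list_gen ys) s n q] p.
  apply: wprod_expand Gp => k x Gx kn.
  by apply: span_ys => //; apply: leq_trans kn nN.
move: p {Gp}; apply: lspan_min (lspan_subspace _) _ => q /(wprod_mons Gys)[m mn qm].
rewrite -[q](subrK m); apply: (subspaceD (lspan_subspace _)).
  by apply: IHr; apply: shorterS qm.
apply: sub_lspan => /=; apply: mons_le nN _ mn.
by apply/allP => -[k x] kx; case: (Gys k x kx).
Qed.

End Products.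

(** * Counting ordered monomials *)

Section Counting.
Variable R : realType.
Implicit Types (d : nat -> nat) (q x : R).

(** Subexponential growth in multiplicative form: [q] stands for the exponential of the rate, and a
    constant replaces the limit, which makes sums and products easy. *)
Definition subexp d := forall q, 1 < q -> exists K, forall n, (d n)%:R <= K * q ^+ n.

Lemma geometric_le x (r : seq nat) n : 0 <= x -> x < 1 -> uniq r ->
  (forall i, i \in r -> i < n)%N -> \sum_(i <- r) x ^+ i <= (1 - x)^-1.
Proof.
move=> x0 x1 ur rn; have x1' : 0 < 1 - x by rewrite subr_gt0.
apply: (@le_trans _ _ (\sum_(i < n) x ^+ i)).
  rewrite -(big_mkord xpredT (fun i => x ^+ i)) [leRHS](bigID (mem r)) /=.
  rewrite -[leLHS]addr0 lerD ?sumr_ge0 // => [|i _]; last exact: exprn_ge0.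
  rewrite -[leRHS]big_filter le_eqVlt; apply/orP; left; apply/eqP.
  apply/perm_big/uniq_perm; rewrite ?filter_uniq ?iota_uniq // => i.
  rewrite mem_filter mem_iota subn0 add0n leq0n /=.
  by case ir : (i \in r); rewrite //= rn.
rewrite -(ler_pM2r x1') mulVf ?lt0r_neq0 // mulrC -opprB mulNr -subrX1 opprB.
by rewrite lerBlDr lerDl exprn_ge0.
Qed.

(** A coefficient is bounded by the value of its generating function at [q^-1] times [q ^+ N]; every
    generator of weight [w] contributes a geometric series in [q ^- w]. *)
Lemma mons_size (F : fieldType) (E : lmodType F) (ys : seq (nat * endo E)) q N :
  1 < q -> all (fun z => 0 < z.1)%N ys ->
  (size (mons ys N))%:R <= q ^+ N * \prod_(z <- ys) (1 - q ^- z.1)^-1.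
Proof.
move=> q1; have q0 : 0 < q by apply: lt_trans q1.
elim: ys N => [|[w y] ys IH] N.
  by move=> _; rewrite big_nil mulr1 exprn_ege1 // ltW.
move=> /andP[]; rewrite -[(w, y).1]/w => w0 ys0.
rewrite monsE size_flatten /shape -map_comp sumnE big_map.
rewrite natr_sum big_cons -[(w, y).1]/w; set P := \prod_(z <- ys) _ in IH *.
set x := q ^- w; have x0 : 0 <= x by rewrite invr_ge0 exprn_ge0 // ltW.
have x1 : x < 1 by rewrite invf_lt1 ?exprn_gt0 // exprn_egt1 // -lt0n.
apply: (@le_trans _ _ (\sum_(e <- iota 0 N.+1 | (e * w <= N)%N) q ^+ N * P * x ^+ e)).
  rewrite big_filter; apply: ler_sum => e eN /=; rewrite size_map.
  apply: le_trans (IH _ ys0) _; rewrite mulrAC ler_wpM2r ?prodr_ge0 //.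
    move=> z _; rewrite invr_ge0 subr_ge0 invf_le1 ?exprn_gt0 //.
    by rewrite exprn_ege1 // ltW.
  rewrite /x -exprVn -exprM [(w * e)%N]mulnC exprVn.
  by rewrite -[in leRHS](subnK eN) exprD mulfK // gt_eqF // exprn_gt0.
rewrite -mulr_sumr -big_filter mulrCA mulrC ler_wpM2r //.
  rewrite mulr_ge0 ?exprn_ge0 ?prodr_ge0 // ?(ltW q0) // => z _.
  rewrite invr_ge0 subr_ge0 invf_le1 ?exprn_gt0 //.
  by rewrite exprn_ege1 // ltW.
apply: (@geometric_le x _ N.+1); rewrite ?filter_uniq ?iota_uniq // => i.
by rewrite mem_filter mem_iota => /and3P[].
Qed.

(** The hypothesis on [c] gives [1 <= (1 + c * x) * (1 - x)], and [1 + c * x] is at most its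
    exponential. *)
Lemma inv_1B_le_expR x c : 0 <= x -> 1 <= c * (1 - x) -> x < 1 ->
  (1 - x)^-1 <= expR (c * x).
Proof.
move=> x0 cx x1; have x1' : 0 < 1 - x by rewrite subr_gt0.
rewrite -(ler_pM2r x1') mulVf ?lt0r_neq0 //.
apply: (@le_trans _ _ ((1 + c * x) * (1 - x))); last first.
  by rewrite ler_wpM2r ?(ltW x1') // expR_ge1Dx.
rewrite mulrDl mul1r -mulrA [x * _]mulrC mulrA.
by have := ler_wpM2r x0 cx; rewrite mul1r => ?; lra.
Qed.

Lemma spanned_basis (F : fieldType) (E : lmodType F) (U : set E) n :
  subspace U -> spanned U n -> exists2 s, (size s <= n)%N & lspan [set` s] = U.
Proof.
move=> Us /(spanned_has_dim Us)[d dn /has_dim_seq[s [_ sd _ sU]]].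
by exists s; rewrite ?sd.
Qed.

(** The generating product over all weights is at most the exponential of a multiple of the sum of
    [d w * q ^- w], which stays bounded because [d] is subexponential. *)
Lemma spanned_products (F : fieldType) (E : lmodType F) (Lam : nat -> set (endo E)) d :
  (forall k, subspace (Lam k)) ->
  (forall k l (x y : endo E), Lam k x -> Lam l y ->
    Lam (k + l)%N (x * y - y * x)) ->
  (forall k, spanned (Lam k) (d k)) -> subexp d ->
  exists2 c, subexp c & forall N, spanned [set p | exists r n,
    (n <= N)%N /\ wprod (pos_gen Lam) r n p] (c N).
Proof.
move=> Lam_sub Lam_comm Lam_d d_sub.
have /choice[Y YP] : forall k, exists s : seq (endo E),
    (size s <= d k)%N /\ lspan [set` s] = Lam k.
  by move=> k; have [s] := spanned_basis (Lam_sub k) (Lam_d k); exists s.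
pose ys N : seq (nat * endo E) := flatten [seq [seq (w, y) | y <- Y w] | w <- iota 1 N].
have ysP N k (x : endo E) : (k, x) \in ys N -> [/\ (0 < k)%N, (k <= N)%N & x \in Y k].
  move=> /flatten_mapP[w]; rewrite mem_iota add1n ltnS => /andP[w0 wN].
  by move=> /mapP[y yY [-> ->]].
have Gys N k (x : endo E) : list_gen (ys N) k x -> pos_gen Lam k x.
  move=> /ysP[k0 _ xY]; split=> //; rewrite -(YP k).2; exact: sub_lspan.
have ys0 N : all (fun z => 0 < z.1)%N (ys N).
  by apply/allP => -[k x] /ysP[].
exists (fun N => size (mons (ys N) N)) => [q q1|N]; last first.
  exists (mons (ys N) N) => // p [r [n [nN Gp]]].
  (* [shorter] is strict in the number of factors, hence the successor. *)
  apply: (shorter_mons Lam_comm (@Gys N) _ (r := r.+1)).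
    move=> k x [k0]; rewrite -(YP k).2 => xk kN; apply: lspanS xk => y /= yY.
    rewrite /list_gen; apply/flatten_mapP; exists k; last exact: map_f.
    by rewrite mem_iota k0 add1n ltnS.
  by apply: sub_lspan; exists r, n.
have q0 : 0 < q by apply: lt_trans q1.
have z1 : q^-1 < 1 by rewrite invf_lt1.
(* Any rate strictly between 1 and [q] makes the sum of the [(p / q) ^+ w] converge. *)
pose p := (1 + q) / 2; have p1 : 1 < p by rewrite /p; lra.
have pq : p / q < 1 by rewrite ltr_pdivrMr // /p; lra.
have p0 : 0 < p by apply: lt_trans p1.
have [K dK] := d_sub p p1.
have K0 : 0 <= K by have := dK 0%N; rewrite mulr1; apply: le_trans.
(* Weights are at least 1, so [q ^- k <= q^-1] and one [c] serves all factors in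
   [inv_1B_le_expR]. *)
pose c := (1 - q^-1)^-1.
exists (expR (c * (K * (1 - p / q)^-1))) => N.
apply: le_trans (mons_size N q1 (ys0 N)) _.
rewrite mulrC ler_wpM2r ?exprn_ge0 ?(ltW q0) //.
apply: (@le_trans _ _ (\prod_(z <- ys N) expR (c * q ^- z.1))).
  rewrite big_seq [leRHS]big_seq; apply: ler_prod => -[k x] /ysP[k0 _ _] /=.
  have xz : q ^- k <= q^-1.
    by rewrite lef_pV2 ?posrE ?exprn_gt0 // ler_eXnr // ltW.
  rewrite invr_ge0 subr_ge0 (le_trans xz) ?(ltW z1) //=.
  apply: inv_1B_le_expR; rewrite ?invr_ge0 ?exprn_ge0 ?(ltW q0) //; last first.
    exact: le_lt_trans xz z1.
  rewrite /c mulrC ler_pdivlMr ?subr_gt0 // mul1r.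
  by rewrite lerD2l lerN2.
rewrite -expR_sum ler_expR -mulr_sumr ler_wpM2l //.
  by rewrite /c invr_ge0 subr_ge0 ltW.
rewrite big_flatten big_map /=.
apply: (@le_trans _ _ (\sum_(w <- iota 1 N) K * (p / q) ^+ w)); last first.
  rewrite -mulr_sumr ler_wpM2l //; apply: (@geometric_le _ _ N.+1) => //.
  - by rewrite divr_ge0 // ltW.
  - exact: iota_uniq.
  - by move=> i; rewrite mem_iota add1n => /andP[].
apply: ler_sum => w _; rewrite big_map /= big_const_seq count_predT iter_addr addr0.
rewrite exprMn mulrA -mulr_natl exprVn ler_wpM2r //.
  by rewrite invr_ge0 exprn_ge0 // ltW.
by apply: le_trans (dK w); rewrite ler_nat; case: (YP w).
Qed.

End Counting.

(** * The sparse generating sequence *)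

Section Brackets.
Variables (F : fieldType) (L : lieAlgType F).
Implicit Types (S T V : set L) (x y : L).

Lemma lspan_amul S T V x y : subspace V ->
  (forall s t, S s -> T t -> V (s ** t)) ->
  lspan S x -> lspan T y -> V (x ** y).
Proof.
move=> Vs STV Sx Ty.
have amul0l (z : L) : 0 ** z = 0.
  by have := amulDl (-1) (0 : L) 0 z; rewrite scaler0 addr0 scaleN1r addNr.
have amul0r (z : L) : z ** 0 = 0.
  by have := amulDr (-1) z (0 : L) 0; rewrite scaler0 addr0 scaleN1r addNr.
suff : S `<=` [set x | V (x ** y)].
  move/lspan_min; apply=> //; split=> [|a u v] /=.
    by rewrite amul0l; apply: subspace0.
  by rewrite amulDl; apply: Vs.2.
move=> s Ss /=; suff : T `<=` [set y | V (s ** y)].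
  move/lspan_min; apply=> //; split=> [|a u v] /=.
    by rewrite amul0r; apply: subspace0.
  by rewrite amulDr; apply: Vs.2.
by move=> t Tt; apply: STV.
Qed.

Lemma power_subspace V n : subspace (power V n).
Proof. exact: lspan_subspace. Qed.

Lemma power_amul V m n x y :
  power V m x -> power V n y -> power V (m + n) (x ** y).
Proof.
apply: lspan_amul; first exact: power_subspace.
move=> s t [k km Vs] [l ln Vt]; apply: sub_lspan; exists (k + l)%N.
  exact: leq_add.
exact: BracketedM.
Qed.

Lemma powerS V m n : (m <= n)%N -> power V m `<=` power V n.
Proof.
by move=> mn; apply: lspanS => x [k km Vx]; exists k => //; apply: leq_trans mn.
Qed.

Lemma sub_power V n x : (0 < n)%N -> V x -> power V n x.
Proof. by move=> n0 Vx; apply: sub_lspan; exists 1%N => //; constructor. Qed.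

Lemma power_power V W C n : (forall x, W x -> power V C x) ->
  power W n `<=` power V (C * n).
Proof.
move=> WV; apply: lspan_min (power_subspace _ _) _ => x [k kn Wx].
suff : power V (C * k) x by apply: powerS; rewrite leq_mul2l kn orbT.
elim: Wx => [v Wv|i j y z _ IHy _ IHz]; first by rewrite muln1; apply: WV.
by rewrite mulnDr; apply: power_amul.
Qed.

Lemma generated_power V x :
  generated_subalgebra V x -> exists n, power V n x.
Proof.
apply: (smallest_sub (X := [set x | exists n, power V n x])); last first.
  by move=> v Vv; exists 1%N; apply: sub_power.
split; first split=> [|a y z [m Vy] [n Vz]].
- by exists 0%N; apply: subspace0 (power_subspace _ _).
- exists (maxn m n); apply: (power_subspace _ _).2.
    by apply: powerS Vy; apply: leq_maxl.
  by apply: powerS Vz; apply: leq_maxr.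
- by move=> y z [m Vy] [n Vz]; exists (m + n)%N; apply: power_amul.
Qed.

Lemma bracketed_gt0 V k x : bracketed V k x -> (0 < k)%N.
Proof. by elim=> // i j _ _ _ i0 _ _; rewrite addn_gt0 i0. Qed.

Lemma spanned_amul S T m n : spanned S m -> spanned T n ->
  spanned [set x ** y | x in S & y in T] (m * n).
Proof.
move=> [s sm Ss] [t tn Tt]; exists [seq x ** y | x <- s, y <- t].
  by rewrite size_allpairs leq_mul.
move=> _ [x Sx [y Ty <-]]; apply: lspan_amul (Ss x Sx) (Tt y Ty).
  exact: lspan_subspace.
by move=> u v us vt; apply: sub_lspan; apply: allpairs_f.
Qed.

(** A product of at least two factors splits at its outermost bracket into two strictly shorter
    products. *)
Lemma power_spanned V m : spanned V m -> forall n, exists k, spanned (power V n) k.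
Proof.
move=> Vm; elim=> [|n [k Vk]].
  by exists 0%N; apply: spanned_lspan; exists [::] => // x [[|l] // _ /bracketed_gt0].
exists (m + k * k)%N; have := spannedU_lspan Vm (spanned_amul Vk Vk).
apply: spannedS; apply: lspanS => x [l ln Vx].
case: Vx ln => [v Vv|i j y z Vy Vz ij]; [by left|right].
have i0 := bracketed_gt0 Vy; have j0 := bracketed_gt0 Vz.
exists y; first by apply: sub_lspan; exists i => //; lia.
by exists z => //; apply: sub_lspan; exists j => //; lia.
Qed.

Lemma fin_dim_spanned V : fin_dim V -> exists m, spanned V m.
Proof.
by case=> d /has_dim_seq[s [_ _ _ sV]]; exists (size s), s; rewrite ?sV.
Qed.

Inductive wbracket (b : nat -> L) : nat -> L -> Prop :=
| Wbracket1 r of (0 < r)%N : wbracket b r (b r)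
| WbracketM k l x y of wbracket b k x & wbracket b l y :
    wbracket b (k + l) (x ** y).

Definition wpower b n : set L :=
  lspan [set x | exists2 k, (k <= n)%N & wbracket b k x].

Lemma wpower_subspace b n : subspace (wpower b n).
Proof. exact: lspan_subspace. Qed.

Lemma wpower_amul b m n x y :
  wpower b m x -> wpower b n y -> wpower b (m + n) (x ** y).
Proof.
apply: lspan_amul; first exact: wpower_subspace.
move=> s t [k km Vs] [l ln Vt]; apply: sub_lspan; exists (k + l)%N.
  exact: leq_add.
exact: WbracketM.
Qed.

End Brackets.

Section Selection.
Variables (R : realType) (F : fieldType) (L : lieAlgType F).
Hypothesis growthL : locally_subexponential_growth R L.
Variable a : nat -> L.

Let S n : set L := [set a i | i in [set i | i <= n]%N].

Lemma local_growth n (q : R) : 1 < q -> exists m0, forall m, (m0 <= m)%N ->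
  exists2 j : nat, spanned (power (S n) m) j & j%:R <= q ^+ m.
Proof.
move=> q1; have q0 : 0 < q by apply: lt_trans q1.
have S_fin : finite_set (S n).
  by apply: finite_image; apply/finite_setP; exists n.+1.
have [V [Vfin VS Vgrowth]] : subexponential_growth R (generated_subalgebra (S n)).
  by apply: growthL; exists (S n).
have [C0 C0P] : exists C, forall x, S n x -> power V C x.
  have : forall i, exists k, (i <= n)%N -> power V k (a i).
    move=> i; case: (leqP i n) => [iN|_]; last by exists 0%N.
    have : generated_subalgebra V (a i) by rewrite VS => U [_]; apply; exists i.
    by move=> /generated_power[k Vk]; exists k.
  move=> /choice[k kP]; exists (\sum_(i < n.+1) k i)%N => _ [i /= iN <-].
  apply: powerS (kP i iN); have iN' : (i < n.+1)%N by [].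
  by rewrite (bigD1 (Ordinal iN')) //= leq_addr.
(* The successor makes [C] positive, as needed for the division by [C] and for [N <= C * m]. *)
pose C := C0.+1; have CP x : S n x -> power V C x.
  by move=> /C0P; apply: powerS.
(* Length [m] over [S n] becomes length [C * m] over [V], so the rate [ln q] is divided by [C] in
   order to end with [q ^+ m]. *)
have alpha0 : 0 < ln q / C%:R by rewrite divr_gt0 // ln_gt0.
have := Vgrowth _ alpha0.
move=> /cvgr_lt/(_ 1 ltr01) [N _ NP]; exists N => m Nm.
have [k0 Vk0] := fin_dim_spanned Vfin.
have [k Vk] := power_spanned Vk0 (C * m).
exists (growth V (C * m)).
  apply: spannedS (power_power CP) _.
  exact: spanned_dimension (power_subspace _ _) Vk.
have /NP : (N <= C * m)%N by apply: leq_trans Nm _; apply: leq_pmull.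
rewrite /= ltr_pdivrMr ?expR_gt0 // mul1r => /ltW /le_trans; apply.
rewrite natrM mulrA divfK ?pnatr_eq0 // -powR_mulrn ?(ltW q0) //.
by rewrite /powR gt_eqF // mulrC.
Qed.

(** If [k n <= N] and [n] is maximal with this property, products of weight at most [N] involve only
    [a 0], ..., [a n] and have at most [N] factors. Choosing [k n] beyond the threshold of
    [local_growth] bounds their span by [q n ^+ N], with [q n] tending to 1. *)
Lemma sparse_sequence : exists b d,
  [/\ subexp R d, forall n, spanned (wpower b n) (d n)
    & forall n, exists2 r, (0 < r)%N & b r = a n].
Proof.
pose q n : R := 1 + n.+1%:R^-1.
have q1 n : 1 < q n by rewrite ltrDl invr_gt0 ltr0n.
have /choice[K KP] := fun n => local_growth n (q1 n).
(* Strictly increasing positions hold one term of [a] each; [k n >= K n] ensures the rate [q n] for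
   all weights from [k n] on. *)
pose k := fix k n := if n is n'.+1 then maxn (K n) (k n').+1 else maxn (K 0%N) 1.
have kK n : (K n <= k n)%N by case: n => [|n]; apply: leq_maxl.
have kS n : (k n < k n.+1)%N by apply: leq_maxr.
have k_gt n : (n < k n)%N.
  elim: n => [|n IH]; first exact: leq_maxr.
  exact: leq_ltn_trans IH (kS n).
have k_lt : {homo k : m n / (m < n)%N} by apply: homo_ltn ltn_trans kS.
have k_inj m n : k m = k n -> m = n.
  by case: (ltngtP m n) => // /k_lt; [move=> + E|move=> + E]; rewrite E ltnn.
pose b r := if [pick n : 'I_r.+1 | k n == r] is Some n then a n else 0.
have bk n : b (k n) = a n.
  rewrite /b; case: pickP => [i /eqP/k_inj -> //|/(_ (Ordinal (leqW (k_gt n))))].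
  by rewrite eqxx.
(* Each nonzero factor [b r] has weight [r >= 1], so weight bounds length. *)
have wb N n : (forall m, (k m <= N)%N -> (m <= n)%N) ->
    wpower b N `<=` power (S n) N.
  move=> Nn; apply: lspan_min (power_subspace _ _) _ => x [w wN wx].
  suff : power (S n) w x by exact: powerS.
  elim: wx wN => [r r0 rN|i j y z _ IHy _ IHz ij]; last first.
    by apply: power_amul; [apply: IHy|apply: IHz]; lia.
  rewrite /b; case: pickP => [i /eqP kr|_]; last exact: subspace0 (power_subspace _ _).
  by apply: sub_power => //; exists i => //=; apply: Nn; rewrite kr.
have S_spanned n : exists m, spanned (S n) m.
  exists (size [seq a i | i <- iota 0 n.+1]), [seq a i | i <- iota 0 n.+1] => //.
  by move=> _ [i iN <-]; apply: sub_lspan; apply: map_f; rewrite mem_iota.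
have wb_fin N : exists m, spanned (wpower b N) m.
  have [m Sm] := S_spanned N; have [j Sj] := power_spanned Sm N.
  exists j; apply: spannedS Sj; apply: wb => l lN.
  exact: leq_trans (ltnW (k_gt l)) lN.
exists b, (fun N => dimension (wpower b N)); split; last 2 first.
- by move=> N; have [m /spanned_dimension] := wb_fin N; apply; apply: wpower_subspace.
- by move=> n; exists (k n) => //; apply: leq_ltn_trans (k_gt n).
move=> p p1.
have [n0 n0P] : exists n0, q n0 <= p.
  have p1' : 0 < p - 1 by rewrite subr_gt0.
  exists (Num.bound (p - 1)^-1); rewrite /q -lerBrDl -[leRHS]invrK lef_pV2.
  - apply: ltW; apply: lt_trans (archi_boundP _) _; first by rewrite invr_ge0 ltW.
    by rewrite ltr_nat.
  - by rewrite posrE ltr0n.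
  - by rewrite posrE invr_gt0.
(* Absorbs the finitely many weights below [k n0], where the rate [p] is not yet guaranteed. *)
pose K0 := (\sum_(i < k n0) dimension (wpower b i))%N.
exists (1 + K0%:R) => N; have pN : 1 <= p ^+ N by rewrite exprn_ege1 // ltW.
have [Nk|kN] := ltnP N (k n0).
  apply: (@le_trans _ _ (K0%:R * 1)); last by rewrite ler_pM // lerDr.
  by rewrite mulr1 ler_nat /K0 (bigD1 (Ordinal Nk)) //= leq_addr.
have ex_n : exists n, (k n <= N)%N by exists n0.
have n_le n : (k n <= N)%N -> (n <= N)%N by apply: leq_trans; apply: ltnW.
case: (ex_maxnP ex_n n_le) => n nN nmax.
have n0n : (n0 <= n)%N by apply: nmax.
have [j Sj jq] := KP n N (leq_trans (kK n) nN).
apply: (@le_trans _ _ (q n ^+ N)).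
  apply: le_trans jq; rewrite ler_nat; apply: dimension_le (wpower_subspace _ _) _.
  by apply: spannedS Sj; apply: wb.
apply: (@le_trans _ _ (p ^+ N)); last by rewrite ler_peMl ?lerDl // (le_trans ler01).
rewrite lerXn2r ?nnegrE ?(ltW (lt_trans ltr01 _)) //.
apply: le_trans n0P; rewrite lerD2l lef_pV2 ?posrE ?ltr0n // ler_nat.
exact: n0n.
Qed.

End Selection.

(** * Growth of finitely generated Lie algebras *)

Section SubexpClosure.
Variable R : realType.
Implicit Types (f g : nat -> nat) (q : R).

Lemma subexp_le f g : (forall n, f n <= g n)%N -> subexp R g -> subexp R f.
Proof.
move=> fg gS q q1; have [K KP] := gS q q1; exists K => n.
by apply: le_trans (KP n); rewrite ler_nat.
Qed.

(** Each factor is bounded at rate [Num.sqrt q], and the two rates multiply to [q]. *)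
Lemma subexpM f g : subexp R f -> subexp R g -> subexp R (fun n => f n * g n)%N.
Proof.
move=> fS gS q q1; have q0 : 0 <= q by rewrite ltW // (lt_trans ltr01).
have p1 : 1 < Num.sqrt q by rewrite -[ltLHS]sqrtr1 ltr_sqrt // (lt_trans ltr01).
have [K KP] := fS _ p1; have [J JP] := gS _ p1; exists (K * J) => n.
rewrite natrM -{1}(sqr_sqrtr q0) -exprM mulnC exprM expr2 mulrACA.
by rewrite ler_pM ?ler0n.
Qed.

Lemma subexpD f g : subexp R f -> subexp R g -> subexp R (fun n => f n + g n)%N.
Proof.
move=> fS gS q q1; have [K KP] := fS _ q1; have [J JP] := gS _ q1.
by exists (K + J) => n; rewrite natrD mulrDl lerD.
Qed.

Lemma subexp_cst k : subexp R (fun=> k).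
Proof.
move=> q q1; exists k%:R => n; rewrite ler_peMr // exprn_ege1 //.
exact: ltW.
Qed.

(** Bernoulli's inequality. *)
Lemma subexpS : subexp R S.
Proof.
move=> q q1; have q10 : 0 < q - 1 by rewrite subr_gt0.
exists (1 + (q - 1)^-1) => n.
have bern : 1 + n%:R * (q - 1) <= q ^+ n.
  elim: n => [|n IH]; first by rewrite mul0r addr0 expr0.
  rewrite exprS; apply: (@le_trans _ _ (q * (1 + n%:R * (q - 1)))).
    rewrite -[n.+1]addn1 natrD; have n0 : 0 <= n%:R :> R by exact: ler0n.
    have : 0 <= n%:R * (q - 1) * (q - 1) by rewrite !mulr_ge0 // ltW.
    by nra.
  by rewrite ler_wpM2l // ltW // (lt_trans ltr01).
have qn1 : 1 <= q ^+ n by rewrite exprn_ege1 // ltW.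
rewrite mulrDl mul1r -[n.+1]addn1 natrD addrC lerD //.
rewrite mulrC ler_pdivlMr //; apply: le_trans bern.
by rewrite lerDr.
Qed.

Lemma subexp_double f : subexp R f -> subexp R (fun n => f n.*2).
Proof.
move=> fS q q1; have q0 : 0 <= q by rewrite ltW // (lt_trans ltr01).
have p1 : 1 < Num.sqrt q by rewrite -[ltLHS]sqrtr1 ltr_sqrt // (lt_trans ltr01).
have [K KP] := fS _ p1; exists K => n; apply: le_trans (KP _) _.
by rewrite -mul2n exprM sqr_sqrtr.
Qed.

(** Half of the rate [alpha] bounds [f]; the other half remains as a geometric sequence tending to
    0. *)
Lemma subexp_subexponential f :
  subexp R f -> subexponential (fun n => (f n)%:R : R).
Proof.
move=> fS alpha a0; have q1 : 1 < expR (alpha / 2) by rewrite expR_gt1 divr_gt0.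
have [K KP] := fS _ q1.
have z1 : `|expR (- (alpha / 2))| < 1.
  by rewrite gtr0_norm ?expR_gt0 // expR_lt1 oppr_lt0 divr_gt0.
have bound n : 0 <= (f n)%:R / expR (alpha * n%:R) <=
    geometric K (expR (- (alpha / 2))) n.
  rewrite divr_ge0 ?ler0n ?expR_ge0 //= /geometric /=.
  rewrite ler_pdivrMr ?expR_gt0 //; apply: le_trans (KP n) _.
  rewrite -!expRM_natl -mulrA -expRD le_eqVlt; apply/orP; left; apply/eqP.
  by congr (_ * expR _); field.
have near_bound : \forall n \near \oo, 0 <= (f n)%:R / expR (alpha * n%:R) <=
    geometric K (expR (- (alpha / 2))) n by apply: nearW.
have cvg0 : (fun=> 0 : R) @ \oo --> (0 : R) by apply: cvg_cst.
exact: (squeeze_cvgr near_bound cvg0 (cvg_geometric K z1)).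
Qed.

End SubexpClosure.

Section GeneratedGrowth.
Variables (R : realType) (F : fieldType) (L : lieAlgType F) (S : set L).
Hypothesis S_fin : finite_set S.
Local Notation M := (gen_lie S).

Definition gen_lift : set M := [set m | S (gen_val m)].

(** The values in [L] of the subalgebra generated inside [M] form a subalgebra containing [S], hence
    exhaust the one generated by [S]. *)
Lemma gen_lift_generates : generated_subalgebra gen_lift = [set: M].
Proof.
apply/seteqP; split=> // m _.
pose K : set L := [set x | exists2 m', generated_subalgebra gen_lift m' & gen_val m' = x].
have [[g0 gP] gM] := generated_subalgebraP (L := M) gen_lift.
have SK : generated_subalgebra S `<=` K.
  apply: smallest_sub; last first.
    move=> x Sx; exists (GenLie (sub_gen_smallest Sx)) => //.
    exact: sub_gen_smallest.
  split; first split.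
  - by exists 0.
  - by move=> a _ _ [x gx <-] [y gy <-]; exists (a *: x + y); first exact: gP.
  - by move=> _ _ [x gx <-] [y gy <-]; exists (x ** y); first exact: gM.
by have [m' gm' /gen_val_inj <-] := SK _ (gen_valP m).
Qed.

Lemma gen_lift_finite : finite_set gen_lift.
Proof.
apply: (finite_preimage (B := S)); last exact: S_fin.
by move=> x y _ _; apply: gen_val_inj.
Qed.

Lemma gen_lie_finitely_generated : finitely_generated [set: M].
Proof. exists gen_lift; [exact: gen_lift_finite|exact: gen_lift_generates]. Qed.

Variables (B : nat -> set L) (c : nat -> nat).
Hypotheses (B_sub : forall n, subspace (B n))
  (B_le : forall m n, (m <= n)%N -> B m `<=` B n)
  (B_mul : forall m n x y, B m x -> B n y -> B (m + n) (x ** y))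
  (B_span : forall n, spanned (B n) (c n)) (S_B : S `<=` B 2)
  (c_subexp : subexp R c).

(** The generators lie in [B 2], so products of at most [n] of them lie in [B n.*2]; the dimension
    bound pulls back along the inclusion of [M]. *)
Lemma gen_lie_subexponential_growth : subexponential_growth R [set: M].
Proof.
have [s sE] : exists s : seq M, gen_lift = [set` s].
  by apply/finite_seqP; exact: gen_lift_finite.
have lift_spanned : spanned (lspan gen_lift) (size s) by exists s; rewrite ?sE.
exists (lspan gen_lift); split.
- have [d _ dP] := spanned_has_dim (lspan_subspace gen_lift) lift_spanned.
  by exists d.
- apply/seteqP; split=> // m _.
  have : generated_subalgebra gen_lift m by rewrite gen_lift_generates.
  apply: smallest_sub; first exact: generated_subalgebraP.
  by move=> x lx; apply: sub_gen_smallest; apply: sub_lspan.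
apply: subexp_subexponential; apply: subexp_le (subexp_double c_subexp) => n.
apply: dimension_le (power_subspace _ _) _.
pose v : {linear M -> L} := @gen_val F L S.
apply: spannedS (spanned_preimage (f := v) _ (B_sub n.*2) (B_span _)); last first.
  exact: gen_val_inj.
have vB k : subspace (v @^-1` B k).
  split=> [|a x y] /=; first exact: subspace0.
  by apply: (B_sub k).2.
apply: lspan_min (vB _) _ => m [k kn km] /=.
apply: (@B_le k.*2); first by rewrite leq_double.
elim: km => [x|i j x y _ IHx _ IHy]; last by rewrite doubleD; apply: B_mul.
by apply: lspan_min (vB 2) _ x => y /S_B.
Qed.

End GeneratedGrowth.

(** * Infinite matrices *)

Section Matrices.
Variables (F : fieldType) (W : lmodType F) (alpha : nat -> endo W).
Local Notation A := (endo W).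
Local Notation E := (nat -> W).
Implicit Types (w : A) (f : E).

Fact munit_linear i j w :
  linear (fun (f : E) (r : nat) => if r == i then w (f j) else 0 : W).
Proof.
move=> a f g; apply/funext => r /=; rewrite !fctE.
by case: eqP => _; rewrite ?linearP // scaler0 addr0.
Qed.

Definition munit i j w : endo E := Endo (munit_linear i j w).

Fact mshift_linear s :
  linear (fun (f : E) (r : nat) => if r == 0%N then 0 else f (r + s)%N : W).
Proof.
move=> a f g; apply/funext => r /=; rewrite !fctE.
by case: eqP => _; rewrite // scaler0 addr0.
Qed.

(** The power [t^s] for [s > 0]. For [s = 0] it is not the identity but the projection that erases
    row 0. *)
Definition mshift s : endo E := Endo (mshift_linear s).

Fact mcol_linear s j w :
  linear (fun (f : E) (r : nat) => if r == 0%N then 0 else alpha (r + s) (w (f j)) : W).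
Proof.
move=> a f g; apply/funext => r /=; rewrite !fctE.
by case: eqP => _; rewrite ?linearP // scaler0 addr0.
Qed.

(** The product [t^s c (w e_(0,j))], where [c] is [mcol 0 0 1]. Row 0 is empty, so only [alpha r]
    with [r > 0] occur. *)
Definition mcol s j w : endo E := Endo (mcol_linear s j w).

Lemma munitP i j : linear (munit i j).
Proof.
move=> a w w'; apply: endoP => f; apply/funext => r.
by rewrite endoDE endoZE /= !fctE; case: eqP; rewrite // scaler0 addr0.
Qed.

Lemma mcolP s j : linear (mcol s j).
Proof.
move=> a w w'; apply: endoP => f; apply/funext => r.
rewrite endoDE endoZE /= !fctE; case: eqP; rewrite ?scaler0 ?addr0 // => _.
exact: linearP.
Qed.

HB.instance Definition _ i j :=
  GRing.isLinear.Build F A (endo E) *:%R (munit i j) (munitP i j).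
HB.instance Definition _ s j :=
  GRing.isLinear.Build F A (endo E) *:%R (mcol s j) (mcolP s j).

Lemma munit_inj i j : injective (munit i j).
Proof.
move=> w w' ww'; apply: endoP => x.
have := congr1 (fun g : endo E => g (fun=> x) i) ww'.
by rewrite /= eqxx.
Qed.

Lemma munit_munit i j w i' j' w' :
  munit i j w * munit i' j' w' = if j == i' then munit i j' (w * w') else 0.
Proof.
apply: endoP => f; apply/funext => r; rewrite endoME /=.
by case: (j == i'); rewrite /= ?linear0 //; case: eqP.
Qed.

Lemma mshift_mshift s s' : mshift s * mshift s' = mshift (s + s').
Proof.
apply: endoP => f; apply/funext => -[|r]; rewrite endoME //=.
by rewrite addSn addSn addnA.
Qed.

(** [t^s] moves row [i] up to row [i - s] and discards what would reach row 0. From rows 0 and 1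
    nothing new arises. *)
Lemma mshift_munit s i j w : (i <= 1)%N ->
  mshift s * munit i j w = if (s == 0%N) && (i == 1%N) then munit i j w else 0.
Proof.
move=> i1; apply: endoP => f; apply/funext => r; rewrite endoME /=.
case: i i1 => [|[|//]] _; case: r => [|r] //=.
- by rewrite andbF.
- by rewrite andbF.
- by rewrite andbT; case: (s == 0%N).
- by rewrite andbT addSn eqSS addn_eq0; case: r => [|r]; case: (s == 0%N).
Qed.

Lemma munit_mshift i j w s :
  munit i j w * mshift s = if j == 0%N then 0 else munit i (j + s) w.
Proof.
apply: endoP => f; apply/funext => r; rewrite endoME /=.
by case: (j == 0%N); rewrite /= ?linear0 //; case: eqP.
Qed.

Lemma munit_mcol i j w s j' w' : munit i j w * mcol s j' w' =
  if j == 0%N then 0 else munit i j' (w * alpha (j + s) * w').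
Proof.
apply: endoP => f; apply/funext => r; rewrite endoME /=.
by case: (j == 0%N); rewrite /= ?linear0 //; case: eqP.
Qed.

Lemma mshift_mcol s s' j w : mshift s * mcol s' j w = mcol (s + s') j w.
Proof.
apply: endoP => f; apply/funext => -[|r]; rewrite endoME //=.
by rewrite addSn addSn addnA.
Qed.

Lemma mcol_mshift s j w s' :
  mcol s j w * mshift s' = if j == 0%N then 0 else mcol s (j + s') w.
Proof.
apply: endoP => f; apply/funext => -[|r]; rewrite endoME /=.
  by case: (j == 0%N).
by case: (j == 0%N); rewrite /= ?linear0.
Qed.

Lemma mcol_munit s j w i j' w' :
  mcol s j w * munit i j' w' = if j == i then mcol s j' (w * w') else 0.
Proof.
apply: endoP => f; apply/funext => -[|r]; rewrite endoME /=.
  by case: (j == i).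
by case: (j == i); rewrite /= ?linear0.
Qed.

Lemma mcol_mcol s j w s' j' w' : mcol s j w * mcol s' j' w' =
  if j == 0%N then 0 else mcol s j' (w * alpha (j + s') * w').
Proof.
apply: endoP => f; apply/funext => -[|r]; rewrite endoME /=.
  by case: (j == 0%N).
by case: (j == 0%N); rewrite /= ?linear0.
Qed.

Variables (U : nat -> set A) (c : nat -> nat).
Hypotheses (U_le : forall m n, (m <= n)%N -> U m `<=` U n)
  (U_mul : forall m n x y, U m x -> U n y -> U (m + n) (x * y))
  (U_alpha : forall r, (0 < r)%N -> U r (alpha r))
  (U_span : forall n, spanned (U n) (c n)).

(** Weights of the three matrix shapes: shifts, column indices and the weight of the entry [w]
    count, row indices do not. *)
Inductive mfilt : nat -> endo E -> Prop :=
| Mfilt_shift s N of (s <= N)%N : mfilt N (mshift s)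
| Mfilt_unit i j m w N of (i <= 1)%N & U m w & (j + m <= N)%N :
    mfilt N (munit i j w)
| Mfilt_col s j m w N of U m w & (s + (j + m) <= N)%N :
    mfilt N (mcol s j w)
| Mfilt0 N : mfilt N 0.

(** When a column [j] meets [t^s c], the entry acquires the factor [alpha (j + s)], whose weight
    [j + s] is exactly what the consumed column and shift had contributed. For [j = 0] the product
    vanishes, so the index of [alpha] is positive. *)
Lemma mfiltM m n x y : mfilt m x -> mfilt n y -> mfilt (m + n) (x * y).
Proof.
have UaU k l r w w' : (0 < r)%N -> U k w -> U l w' -> U (k + r + l) (w * alpha r * w').
  by move=> r0 Uw Uw'; do 2!apply: U_mul => //; apply: U_alpha.
move=> [s {}m sm|i j k w {}m i1 Uw jm|s j k w {}m Uw jm|{}m]; last first.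
- by rewrite mul0r; constructor.
- move=> [s' {}n sn|i' j' k' w' {}n i1' Uw' jn|s' j' k' w' {}n Uw' jn|{}n].
  + rewrite mcol_mshift; case: eqP => [_|j0]; first by constructor.
    by apply: (Mfilt_col Uw); lia.
  + rewrite mcol_munit; case: eqP => [_|_]; last by constructor.
    by apply: (Mfilt_col (U_mul Uw Uw')); lia.
  + rewrite mcol_mcol; case: eqP => [_|/eqP j0]; first by constructor.
    by apply: (Mfilt_col (UaU k k' (j + s')%N w w' _ Uw Uw')); lia.
  + by rewrite mulr0; constructor.
- move=> [s' {}n sn|i' j' k' w' {}n i1' Uw' jn|s' j' k' w' {}n Uw' jn|{}n].
  + rewrite munit_mshift; case: eqP => [_|j0]; first by constructor.
    by apply: (Mfilt_unit i1 Uw); lia.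
  + rewrite munit_munit; case: eqP => [_|_]; last by constructor.
    by apply: (Mfilt_unit i1 (U_mul Uw Uw')); lia.
  + rewrite munit_mcol; case: eqP => [_|/eqP j0]; first by constructor.
    by apply: (Mfilt_unit i1 (UaU k k' (j + s')%N w w' _ Uw Uw')); lia.
  + by rewrite mulr0; constructor.
- move=> [s' {}n sn|i' j' k' w' {}n i1' Uw' jn|s' j' k' w' {}n Uw' jn|{}n].
  + by rewrite mshift_mshift; constructor; lia.
  + rewrite mshift_munit //; case: ifP => _; last by constructor.
    by apply: (Mfilt_unit i1' Uw'); lia.
  + by rewrite mshift_mcol; apply: (Mfilt_col Uw'); lia.
  + by rewrite mulr0; constructor.
Qed.

Definition mpow N : set (endo E) := lspan (mfilt N).

Lemma mpow_subspace N : subspace (mpow N).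
Proof. exact: lspan_subspace. Qed.

Lemma mpow_le m n : (m <= n)%N -> mpow m `<=` mpow n.
Proof.
move=> mn; apply: lspanS => x mx.
case: mx mn => [s {}m sm|i j k w {}m i1 Uw jm|s j k w {}m Uw jm|{}m] mn.
- by constructor; lia.
- by apply: (Mfilt_unit i1 Uw); lia.
- by apply: (Mfilt_col Uw); lia.
- exact: Mfilt0.
Qed.

Lemma mpow_amul m n x y : mpow m x -> mpow n y -> mpow (m + n) (x ** y).
Proof.
apply: lspan_amul; first exact: mpow_subspace.
move=> s t ms nt; rewrite endo_bracketE.
apply: (subspaceB (mpow_subspace _)); apply: sub_lspan; first exact: mfiltM.
by rewrite addnC; apply: mfiltM.
Qed.

(** In weight [N] the indices [s] and [j] are at most [N] and the row [i] takes two values; the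
    summands count shifts, units and columns. *)
Lemma mpow_spanned N :
  spanned (mpow N) (N.+1 + (2 * (N.+1 * c N) + N.+1 * (N.+1 * c N))).
Proof.
have sum_const k n : (\sum_(i <- iota 0 n) k = n * k)%N.
  by rewrite big_const_seq count_predT size_iota iter_addn_0 mulnC.
have shifts : spanned [set mshift s | s in [set s | s <= N]%N] N.+1.
  exists [seq mshift s | s <- iota 0 N.+1]; first by rewrite size_map size_iota.
  move=> _ [s sN <-]; apply: sub_lspan; apply: map_f.
  by rewrite mem_iota.
have units : spanned [set x | exists2 i, i \in iota 0 2 &
    exists2 j, j \in iota 0 N.+1 & (munit i j @` U N) x] (2 * (N.+1 * c N)).
  rewrite -sum_const; apply: spanned_bigcup => i _.
  rewrite -sum_const; apply: spanned_bigcup => j _.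
  exact: spanned_image.
have cols : spanned [set x | exists2 s, s \in iota 0 N.+1 &
    exists2 j, j \in iota 0 N.+1 & (mcol s j @` U N) x] (N.+1 * (N.+1 * c N)).
  rewrite -sum_const; apply: spanned_bigcup => s _.
  rewrite -sum_const; apply: spanned_bigcup => j _.
  exact: spanned_image.
apply: spannedS (spannedU_lspan shifts (spannedU_lspan units cols)).
apply: lspan_min (lspan_subspace _) _ => x Nx.
case: Nx shifts units cols => [s {}N sN|i j m w {}N i1 Uw jN|s j m w {}N Uw jN|{}N] _ _ _.
- by apply: sub_lspan; left; exists s.
- apply: sub_lspan; right; apply: sub_lspan; left.
  exists i; first by rewrite mem_iota; lia.
  exists j; first by rewrite mem_iota; lia.
  by exists w => //; apply: U_le Uw; lia.
- apply: sub_lspan; right; apply: sub_lspan; right.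
  exists s; first by rewrite mem_iota; lia.
  exists j; first by rewrite mem_iota; lia.
  by exists w => //; apply: U_le Uw; lia.
- exact: (subspace0 (lspan_subspace _)).
Qed.

End Matrices.

(** * Operators with commutator 1 that commute with the given action *)

Section Heisenberg.
Variables (F : fieldType) (V : lmodType F).
Local Notation W := (nat -> V).
Implicit Types (f g : endo V).

Fact lift_linear f : linear (fun (u : W) n => f (u n)).
Proof. by move=> a u v; apply/funext => n; rewrite /= !fctE linearP. Qed.

Definition lift f : endo W := Endo (lift_linear f).

Lemma liftP : linear lift.
Proof. by move=> a f g; apply: endoP. Qed.

HB.instance Definition _ :=
  GRing.isLinear.Build F (endo V) (endo W) *:%R lift liftP.

Lemma liftM f g : lift (f * g) = lift f * lift g.
Proof. exact: endoP. Qed.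

Lemma lift_inj : injective lift.
Proof.
move=> f g fg; apply: endoP => x.
exact: (congr1 (fun h : endo W => h (fun=> x) 0%N) fg).
Qed.

Fact lower_linear : linear (fun (u : W) n => u n.+1 *+ n.+1).
Proof.
by move=> a u v; apply/funext => n; rewrite /= !fctE mulrnDl scalerMnr.
Qed.

(** With [u] read as the formal power series with coefficients [u n] in V, this is differentiation,
    and [raise] is multiplication by the variable. *)
Definition lower : endo W := Endo lower_linear.

Fact raise_linear : linear (fun (u : W) n => if n is n'.+1 then u n' else 0).
Proof.
by move=> a u v; apply/funext => -[|n]; rewrite /= !fctE // scaler0 addr0.
Qed.

Definition raise : endo W := Endo raise_linear.

Lemma lower_raise : lower * raise - raise * lower = 1.
Proof.
apply: endoP => u; apply/funext => -[|n]; rewrite endoBE /= !fctE /=.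
  by rewrite subr0.
by rewrite [_ *+ n.+2]mulrS addrK.
Qed.

Lemma lift_lower f : lift f * lower = lower * lift f.
Proof. by apply: endoP => u; apply/funext => n; rewrite !endoME /= linearMn. Qed.

Lemma lift_raise f : lift f * raise = raise * lift f.
Proof.
by apply: endoP => u; apply/funext => -[|n]; rewrite !endoME //= linear0.
Qed.

End Heisenberg.

(** * The Lie algebra generated by the five matrices *)

Section Embedding.
Variables (R : realType) (F : fieldType) (L : lieAlgType F) (V : lmodType F).
Variables (rho : {linear L -> endo V}) (b : nat -> L) (d : nat -> nat).
Hypotheses (rhoM : lie_hom rho) (rho_inj : injective rho) (d_subexp : subexp R d)
  (b_growth : forall n, spanned (wpower b n) (d n))
  (b_span : lspan [set b r | r in [set r | 0 < r]%N] = [set: L]).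
Local Notation W := (nat -> V).
Local Notation p := (lower V).
Local Notation q := (raise V).

Let sigma : {linear L -> endo W} := @lift F V \o rho.

Let sigmaM x y : sigma (x ** y) = sigma x * sigma y - sigma y * sigma x.
Proof. by rewrite /= rhoM endo_bracketE linearB /= !liftM. Qed.

(** Placing [p], [q] and 1 in every weight costs three dimensions; 1 is present because it is the
    commutator of [p] and [q]. *)
Let Lam n : set (endo W) :=
  lspan (sigma @` wpower b n `|` [set` [:: p; q; 1]]).

Let Lam_comm k l (x y : endo W) :
  Lam k x -> Lam l y -> Lam (k + l)%N (x * y - y * x).
Proof.
rewrite -endo_bracketE; apply: lspan_amul; first exact: lspan_subspace.
have Lam0 n : Lam n 0 by apply: subspace0 (lspan_subspace _).
have Lam1 n : Lam n 1 by apply: sub_lspan; right; rewrite /= !inE eqxx !orbT.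
have pq0 z (x' : L) : z \in [:: p; q; 1] -> sigma x' * z - z * sigma x' = 0.
  rewrite !inE => /or3P[] /eqP ->; rewrite /= ?lift_lower ?lift_raise ?subrr //.
  by rewrite mulr1 mul1r subrr.
move=> s t [[x' bx' <-]|ps] [[y' by' <-]|pt]; rewrite endo_bracketE.
- rewrite -sigmaM; apply: sub_lspan; left; exists (x' ** y') => //.
  exact: wpower_amul.
- by rewrite pq0.
- by rewrite -opprB pq0 // oppr0.
- move: ps pt; rewrite /= !inE => /or3P[] /eqP -> /or3P[] /eqP ->;
    rewrite ?mulr1 ?mul1r ?subrr ?lower_raise //.
  by rewrite -opprB lower_raise; apply: (subspaceN (lspan_subspace _)); apply: Lam1.
Qed.

Let Lam_span n : spanned (Lam n) (d n + 3).
Proof.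
apply: spannedU_lspan; first by apply: spanned_image.
by exists [:: p; q; 1] => //; apply: sub_lspan.
Qed.

Let U n : set (endo W) :=
  [set x | exists r m, (m <= n)%N /\ wprod (pos_gen Lam) r m x].

Let U_le m n : (m <= n)%N -> U m `<=` U n.
Proof.
by move=> mn x [r [k [km Gx]]]; exists r, k; split=> //; apply: leq_trans mn.
Qed.

Let U_mul m n x y : U m x -> U n y -> U (m + n)%N (x * y).
Proof.
move=> [r [k [km Gx]]] [s [l [ln Gy]]]; exists (r + s)%N, (k + l)%N.
by split; [apply: leq_add|apply: wprod_mul].
Qed.

Let U_gen n x : (0 < n)%N -> Lam n x -> U n x.
Proof.
move=> n0 Lx; exists 1%N, n; split=> //.
by rewrite -[x]mulr1 -[n in wprod _ _ n]addn0; constructor => //; constructor.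
Qed.

Let alpha r := sigma (b r).

Let U_alpha r : (0 < r)%N -> U r (alpha r).
Proof.
move=> r0; apply: U_gen => //; apply: sub_lspan; left; exists (b r) => //.
by apply: sub_lspan; exists r => //; constructor.
Qed.

Let gens : set (endo (nat -> W)) := [set` [:: mcol alpha 0 0 1; mshift W 1;
  munit 1 1 1; munit 0 1 p; munit 1 1 q]].

(** The value 2 comes from [munit 0 1 p] and [munit 1 1 q]: column 1, plus weight 1 for the
    entry. *)
Let gens_mpow : gens `<=` mpow alpha U 2.
Proof.
have U1 n : U n 1 by exists 0%N, 0%N; split=> //; constructor.
have Up : U 1 p by apply: U_gen => //; apply: sub_lspan; right; rewrite /= !inE eqxx.
have Uq : U 1 q.
  by apply: U_gen => //; apply: sub_lspan; right; rewrite /= !inE eqxx orbT.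
move=> x; rewrite /gens /= !inE => xg; apply: sub_lspan; move: xg.
case/or4P=> [/eqP->|/eqP->|/eqP->|/orP[]/eqP->].
- by apply: (Mfilt_col _ (U1 0%N)).
- by constructor.
- by apply: (Mfilt_unit _ _ (U1 0%N)).
- by apply: (Mfilt_unit _ _ Up).
- by apply: (Mfilt_unit _ _ Uq).
Qed.

Local Notation G := (generated_subalgebra gens).

Let G_munit l : G (munit 1 1 (sigma l)).
Proof.
have [Gs Gm] := generated_subalgebraP gens.
have Gg x : gens x -> G x by apply: sub_gen_smallest.
have Gc : G (mcol alpha 0 0 1) by apply: Gg; rewrite /gens /= !inE eqxx.
have Gt : G (mshift W 1) by apply: Gg; rewrite /gens /= !inE eqxx ?orbT.
have Gz : G (munit 1 1 1) by apply: Gg; rewrite /gens /= !inE eqxx ?orbT.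
have Gp : G (munit 0 1 p) by apply: Gg; rewrite /gens /= !inE eqxx ?orbT.
have Gq : G (munit 1 1 q) by apply: Gg; rewrite /gens /= !inE eqxx ?orbT.
(* The bracket with [t] raises the column by one, as [t e_(1,j) = 0]. *)
have Ge r : G (munit 1 r.+1 1).
  elim: r => // r IH; have := Gm _ _ IH Gt.
  by rewrite endo_bracketE munit_mshift mshift_munit //= subr0 addn1.
have : lspan [set b r | r in [set r | 0 < r]%N] l by rewrite b_span.
apply: (lspan_min (U := [set l | G (munit 1 1 (sigma l))])).
  split=> [|a x y Gx Gy] /=.
    by rewrite !linear0; apply: subspace0.
  have -> : munit 1 1 (sigma (a *: x + y)) =
      a *: munit 1 1 (sigma x) + munit 1 1 (sigma y).
    by rewrite (linearP sigma) (linearP (munit 1 1)).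
  exact: (Gs.2 a _ _ Gx Gy).
move=> _ [[|r] // _ <-] /=; rewrite -[lift _]/(alpha r.+1).
(* The other product [c e_(1,r+1)] vanishes because [c] lives in column 0. *)
have Gr : G (munit 1 0 (alpha r.+1)).
  have := Gm _ _ (Ge r) Gc; rewrite endo_bracketE munit_mcol mcol_munit /=.
  by rewrite subr0 addn0 mul1r mulr1.
(* Write [x] for [alpha r.+1]. The inner bracket is [x p e_(1,1) - p x e_(0,0)]; bracketing with
   [q e_(1,1)] kills the second term and turns the first into [x (pq - qp) e_(1,1)]. *)
have := Gm _ _ (Gm _ _ Gr Gp) Gq.
rewrite !endo_bracketE !munit_munit /= mulrBl mulrBr !munit_munit /= subr0 subr0.
have qa : q * alpha r.+1 = alpha r.+1 * q by rewrite -lift_raise.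
by rewrite -linearB /= [q * _]mulrA qa -!mulrA -mulrBr lower_raise mulr1.
Qed.

Lemma finitely_generated_embedding : exists M : lieAlgType F,
  [/\ finitely_generated [set: M], subexponential_growth R [set: M]
    & exists f : {linear L -> M}, lie_hom f /\ injective f].
Proof.
have gens_fin : finite_set gens by apply: finite_seq.
have dS : subexp R (fun n => d n + 3)%N by apply: subexpD => //; apply: subexp_cst.
have [c cS U_span] := spanned_products (fun n => lspan_subspace _) Lam_comm Lam_span dS.
exists (gen_lie gens); split; first exact: gen_lie_finitely_generated.
  apply: (gen_lie_subexponential_growth gens_fin (@mpow_subspace _ _ alpha U)
    (@mpow_le _ _ alpha U) _ (mpow_spanned alpha U_le U_span) gens_mpow).
    by move=> m n x y; apply: mpow_amul.
  apply: subexpD; first exact: subexpS.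
  have cS' : subexp R (fun n => n.+1 * c n)%N.
    by apply: subexpM => //; apply: subexpS.
  by apply: subexpD; apply: subexpM => //; [apply: subexp_cst|apply: subexpS].
(* Multiplicativity comes from [e_(1,1)] being idempotent. *)
pose f0 l : gen_lie gens := GenLie (G_munit l).
have f0_linear : linear f0.
  by move=> a x y; apply: gen_val_inj; rewrite /= 3!linearP.
pose fL := GRing.isLinear.Build F L (gen_lie gens) *:%R f0 f0_linear.
pose f : {linear L -> gen_lie gens} := HB.pack f0 fL.
exists f; split=> [x y|x y fxy].
  apply: gen_val_inj; rewrite gen_valM /= endo_bracketE !munit_munit /=.
  by rewrite -linearB -sigmaM.
apply: rho_inj; apply: lift_inj; apply: (@munit_inj _ _ 1 1).
exact: (congr1 (@gen_val _ _ gens) fxy).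
Qed.

End Embedding.

Theorem theorem1 (R : realType) (F : fieldType) (charF : 2%N \notin [pchar F])
    (L : lieAlgType F) (dimL : countable_dim L)
    (growthL : locally_subexponential_growth R L) :
  exists M : lieAlgType F,
    [/\ finitely_generated [set: M],
        subexponential_growth R [set: M]
      & exists f : {linear L -> M}, lie_hom f /\ injective f].
Proof.
have [B [B_free B_span] /countable_injP[g gI]] := dimL.
have [rho [rhoM rho_inj]] := countable_dim_embedding B_free B_span gI.
(* Enumerates [B] along [g], with 0 at the indices that [g] misses on [B]. *)
pose a i := xget 0 [set x | B x /\ g x = i].
have [b [d [d_subexp b_growth ba]]] := sparse_sequence growthL a.
apply: (finitely_generated_embedding rhoM rho_inj d_subexp b_growth).
apply/seteqP; split=> // l _; have : lspan B l by rewrite B_span.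
apply: lspanS => x Bx; have [r r0 br] := ba (g x); exists r => //.
rewrite br /a; case: xgetP => [y -> [By gxy]|/(_ x)[]//].
by apply: gI; rewrite ?inE.
Qed.
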